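(* Let $0<p,q<1$ be fixed and let $G=(V,E)\sim\mathcal G_{n,p,q}$ be a graph sampled according to the stochastic block model with two communities of size $n$ each. Then, with high probability, for every pair of vertices $w\ne v$ the hitting time $T_{w,v}$ satisfies $$\mathbb E[T_{w,v}]=\frac{2|E|}{\deg v}-1+\frac{2}{p+q}\,1_{w\not\sim v}+\begin{cases}-\dfrac{(q-p)^2}{(p+q)^2} & \text{if } w\simeq v,\\[2mm] +\dfrac{p(q-p)^2}{q(p+q)^2} & \text{if } w\not\simeq v\end{cases}\;+\;\mathcal O_{p,q}\!\left(\sqrt{\frac{\log^5 n}{n}}\right).$$
   Context: $\mathcal G_{n,p,q}$ is the law of the random simple graph on $2n$ vertices, partitioned into two communities of $n$ vertices each, in which all pairs of distinct vertices are joined independently, with probability $p$ if the two vertices are in the same community and with probability $q$ if they are in different communities. $w\simeq v$ means that $w$ and $v$ are in the same community. ''With high probability'' means with probability tending to $1$ as $n\to\infty$. The notation $\mathcal O_{p,q}$ means that the implicit constant depends only on $p,q$; the bound is uniform over all pairs $w\neq v$. For a connected graph $G$ and $w\ne v$, $T_{w,v}$ is the first time that simple random walk on $G$ started at $w$ (which at each step moves to a uniformly chosen neighbor) hits $v$; $\mathbb E[T_{w,v}]$ is the expectation over the walk, with the graph $G$ fixed. $|E|$ is the number of edges, $\deg v$ the number of neighbors of $v$, and $1_{w\not\sim v}$ the indicator that $w$ and $v$ are not adjacent. $\log^5 n=(\log n)^5$. *)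

(* Defs.v *)
From HB Require Import structures.
From mathcomp Require Import all_boot all_order all_algebra.
From mathcomp Require Import all_classical all_reals all_analysis.
Import Order.TTheory GRing.Theory Num.Theory.
Import numFieldNormedType.Exports.

Set Implicit Arguments.
Unset Strict Implicit.
Unset Printing Implicit Defensive.

Local Open Scope classical_set_scope.
Local Open Scope ring_scope.

(* A simple graph on V is its set of edges, an edge being a two-element set. *)
Definition sgraph (V : finType) :=
  {E : {set {set V}} | [forall e in E, #|e| == 2%N]}.

Definition edges (V : finType) (G : sgraph V) : {set {set V}} := val G.

Definition adj (V : finType) (G : sgraph V) : rel V :=
  [rel x y | [set x; y]%SET \in edges G].

Definition deg (V : finType) (G : sgraph V) (x : V) : nat :=
  #|[set y | adj G x y]%SET|.

Section SimpleRandomWalk.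
Variables (R : realType) (V : finType) (G : sgraph V).

(* The value is 0 for all y if x is isolated: the walk is then killed at x. *)
Definition step (x y : V) : R := (adj G x y)%:R / (deg G x)%:R.

(* Probability that the walk started at w has x 0, ..., x t as its positions
   at times 0, ..., t. *)
Definition walk_prob (w : V) (t : nat) (x : {ffun 'I_t.+1 -> V}) : R :=
  (x ord0 == w)%:R * \prod_(i < t) step (x (inord i)) (x (inord i.+1)).

(* P(T_{w,v} = t). *)
Definition hit_prob (w v : V) (t : nat) : R :=
  \sum_(x : {ffun 'I_t.+1 -> V} |
        (x ord_max == v) && [forall i : 'I_t.+1, (i < t)%N ==> (x i != v)])
    walk_prob w x.

(* T_{w,v} takes its values in {0, 1, 2, ...} and +oo, the mass missing from
   the finite values being P(T_{w,v} = +oo); recall that +oo * 0 = 0.  Thus the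
   expectation is +oo as soon as the walk has a positive probability of never
   hitting v, in particular if w and v lie in different components of G. *)
Definition mean_hit (w v : V) : \bar R :=
  (\sum_(0 <= t <oo) (t%:R * hit_prob w v t)%:E
   + +oo * (1 - \sum_(0 <= t <oo) (hit_prob w v t)%:E))%E.

End SimpleRandomWalk.

(* The first component of a vertex is its community. *)
Definition sbm_vertex (n : nat) : finType := (bool * 'I_n)%type.

Definition same_comm (n : nat) (w v : sbm_vertex n) : bool := w.1 == v.1.

Section StochasticBlockModel.
Variables (R : realType) (n : nat) (p q : R).

Definition edge_prob (e : {set sbm_vertex n}) : R :=
  if [forall x in e, forall y in e, same_comm x y] then p else q.

Definition sbm_law (G : sgraph (sbm_vertex n)) : R :=
  \prod_(e : {set sbm_vertex n} | #|e| == 2%N)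
    (if e \in edges G then edge_prob e else 1 - edge_prob e).

Definition sbm_prob (A : set (sgraph (sbm_vertex n))) : R :=
  \sum_(G in A) sbm_law G.

End StochasticBlockModel.

(* Main.v *)
Require Import Defs.
From HB Require Import structures.
From mathcomp Require Import all_boot all_order all_algebra.
From mathcomp Require Import all_classical all_reals all_analysis.
From mathcomp Require Import ring lra.
Import Order.TTheory GRing.Theory Num.Theory.
Import numFieldNormedType.Exports.

(** Write P for the transition matrix of the walk, fix the target v, and put
N = 2|E| / deg v and a = p + q.

The mean hitting time h is about N, of order n, and the theorem describes it
up to o(1).  The equations h = 1 + P h off v determine h, and reversibility
turns them into h = 1 - N delta_v + P h on all vertices ([return_time], the
formula of Kac).  Iterating once and subtracting the equation at v gives, for
w <> v and with P2 = P^2 ([two_step_equation]),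

  h(w) - N = - N P(w,v) + N (P2(v,v) - P2(w,v))
             + sum_(u <> v) (P2(w,u) - P2(v,u)) (h(u) - N).

The large constant N has disappeared from the sum, since the rows of P2 have
the same total: the unknown is now h - N, which is of order one, so that a
relative error in P2 costs no more than its own size.

Unlike the adjacency matrix, P2 is nearly constant on blocks.  Its entries are
governed by degrees and by numbers of common neighbours, which are sums of
independent variables.  A Chernoff bound and a union bound over pairs of
vertices show that with high probability all of them are within a relative
error eta = O(sqrt (log n / n)) of their means ([sbm_prob_typical]).  On such
a typical graph n P2(w,u) is p^2 + q^2 or 2pq, divided by a^2, up to O(eta),
according to the communities of w <> u, and n P2(v,v) is 1/a
([two_step_offdiag], [two_step_diag]).

In the limit the kernel n (P2(w,u) - P2(v,u)) vanishes when w is in the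
community of v; when it is not, the kernel is + mu or - mu according to the
community of u, where mu = (q - p)^2 / a^2 < 1.  The claimed correction solves
the system with this limiting kernel up to O(eta) ([correction_consistent]),
and the system is stable: a solution with a small source is small
([block_stability]).  Applied to the difference of h - N and the correction,
these facts bound the error by O(eta) ([hitting_time_expansion]), which is
below the stated order because log n <= log^5 n.

The expectation is defined by a series over trajectories.  On a typical graph
any two vertices have a common neighbour, so a maximum principle for P2 bounds
the partial sums and shows that v is reached almost surely; hence the
expectation is finite and solves the equations for h ([mean_hit_system]). *)

Set Implicit Arguments.
Unset Strict Implicit.
Unset Printing Implicit Defensive.

Local Open Scope classical_set_scope.
Local Open Scope ring_scope.

(** * Edges, degrees and neighbourhoods *)

Section Graph.
Variables (V : finType) (G : sgraph V).

Lemma adjC x y : adj G x y = adj G y x.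
Proof. by rewrite /adj /= finset.setUC. Qed.

Lemma card_edge e : e \in edges G -> #|e| = 2%N.
Proof. by move=> eG; apply/eqP; have /'forall_implyP := valP G; apply. Qed.

Lemma adjxx x : adj G x x = false.
Proof.
by apply/negP => /card_edge; rewrite finset.setUid cards1.
Qed.

Lemma adj_neq x y : adj G x y -> x != y.
Proof. by apply: contraTneq => ->; rewrite adjxx. Qed.

(** The map from a neighbour y of x to the edge {x, y} is injective. *)
Lemma deg_incident x : deg G x = #|[set e in edges G | x \in e]%SET|.
Proof.
have inj : {in [set y | adj G x y]%SET &, injective (fun y => [set x; y]%SET)}.
  move=> y z; rewrite !inE => xy xz /setP /(_ y).
  rewrite !inE eqxx orbT => /esym /orP[|/eqP//].
  by move=> /eqP yx; move: xy; rewrite yx adjxx.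
rewrite /deg -(card_in_imset inj); apply: eq_card => e; rewrite inE.
apply/imsetP/andP => [[y]|[eG xe]].
  by rewrite inE => xy ->; split; rewrite // !inE eqxx.
have /cards2P[a [b [ab eab]]]: #|e| == 2%N by rewrite (card_edge eG).
move: xe; rewrite eab !inE => /orP[/eqP xa|/eqP xb].
  by exists b; rewrite ?inE /adj /= xa -?eab.
by exists a; rewrite ?inE /adj /= xb finset.setUC -?eab.
Qed.

Lemma sum_deg : (\sum_x deg G x = 2 * #|edges G|)%N.
Proof.
under eq_bigr do rewrite deg_incident -sum1dep_card.
transitivity (\sum_(e in edges G) #|e|)%N; last first.
  by rewrite (eq_bigr (fun=> 2%N)) ?sum_nat_const 1?mulnC // => e /card_edge.
under [RHS]eq_bigr do rewrite -sum1_card.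
rewrite (exchange_big_dep (mem (edges G))) /= => [|x e _ /andP[] //].
by apply: eq_bigr => e eG; apply: eq_bigl => x; rewrite eG.
Qed.

End Graph.

(** * Hitting times solve a linear system *)

Section HittingTimes.
Variables (R : realType) (V : finType) (G : sgraph V).
Implicit Types (w v x y : V) (t : nat).

Definition prepend t (p : V * {ffun 'I_t.+1 -> V}) : {ffun 'I_t.+2 -> V} :=
  [ffun i => oapp p.2 p.1 (unlift ord0 i)].

Lemma prepend0 t p : @prepend t p ord0 = p.1.
Proof. by rewrite ffunE unlift_none. Qed.

Lemma prepend_lift t p j : @prepend t p (lift ord0 j) = p.2 j.
Proof. by rewrite ffunE liftK. Qed.

Lemma prepend_bij t : bijective (@prepend t).
Proof.
exists (fun x : {ffun _ -> V} => (x ord0, [ffun j => x (lift ord0 j)])) => [[w y]|x].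
  by rewrite prepend0; congr (_, _); apply/ffunP => j; rewrite ffunE prepend_lift.
apply/ffunP => i; case: (unliftP ord0 i) => [j|] ->.
  by rewrite prepend_lift ffunE.
by rewrite prepend0.
Qed.

Lemma hit_prob0 w v : hit_prob R G w v 0 = (w == v)%:R.
Proof.
rewrite /hit_prob /walk_prob (reindex (fun x : V => [ffun _ : 'I_1 => x])) /=.
  rewrite (big_pred1 v) => [|x].
    by rewrite ffunE big_ord0 mulr1 eq_sym.
  by rewrite ffunE; apply: andb_idr => _; apply/forallP.
apply: onW_bij; exists (fun y : {ffun 'I_1 -> V} => y ord0) => [x|y].
  by rewrite ffunE.
by apply/ffunP => i; rewrite ffunE [in RHS](ord1 i).
Qed.

(** The Markov property at time 1, read off by splitting each trajectory into its
    first position and the rest. *)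
Lemma hit_probS w v t : hit_prob R G w v t.+1 =
  (w != v)%:R * \sum_u step R G w u * hit_prob R G u v t.
Proof.
have inordS k : (k < t.+1)%N -> inord k.+1 = lift ord0 (inord k : 'I_t.+1) :> 'I_t.+2.
  by move=> kt; apply/val_inj; rewrite /= !inordK.
have inord0 k : inord 0 = ord0 :> 'I_k.+1 by apply/val_inj; rewrite /= inordK.
rewrite {1}/hit_prob (reindex (@prepend t)) /=; last exact/onW_bij/prepend_bij.
pose ends_at_v (y : {ffun 'I_t.+1 -> V}) :=
  (y ord_max == v) && [forall i : 'I_t.+1, (i < t)%N ==> (y i != v)].
pose weight (y : {ffun 'I_t.+1 -> V}) : R :=
  \prod_(i < t) step R G (y (inord i)) (y (inord i.+1)).
transitivity (\sum_(p | (p.1 != v) && ends_at_v p.2)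
   (p.1 == w)%:R * (step R G p.1 (p.2 ord0) * weight p.2)).
  apply: eq_big => [[x y]|[x y] _] /=.
    have -> : ord_max = lift ord0 (ord_max : 'I_t.+1) by exact/val_inj.
    rewrite prepend_lift andbCA; congr (_ && _).
    apply/forallP/andP => [xyv|[xv yv] i].
      split; first by have := xyv ord0; rewrite prepend0.
      by apply/forallP => i; have := xyv (lift ord0 i); rewrite prepend_lift.
    case: (unliftP ord0 i) => [j|] ->; rewrite ?prepend0 ?prepend_lift.
      exact: (forallP yv j).
    by rewrite xv implybT.
  rewrite /walk_prob prepend0 /= big_ord_recl /=; congr (_ * (_ * _)).
    by rewrite inordS // !inord0 prepend0 prepend_lift.
  apply: eq_bigr => i _; rewrite /bump leq0n add1n.
  by have it := ltn_ord i; rewrite !inordS ?prepend_lift ?ltnS ?(ltnW it).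
rewrite -(pair_big (fun x : V => x != v) ends_at_v
  (fun (x : V) (y : {ffun 'I_t.+1 -> V}) => (x == w)%:R * (step R G x (y ord0) * weight y))) /=.
rewrite (eq_bigr (fun x : V => (x == w)%:R *
  \sum_(y | ends_at_v y) step R G w (y ord0) * weight y)); last first.
  move=> x _; rewrite mulr_sumr; apply: eq_bigr => y _.
  by case: eqP => [->//|_]; rewrite !mul0r.
rewrite -mulr_suml; congr (_ * _).
  case: (eqVneq w v) => [->|wv].
    by rewrite big1 // => x /negPf ->.
  rewrite (bigD1 w) //= eqxx big1 ?addr0 // => x /andP[_ /negPf->//].
rewrite /hit_prob -/ends_at_v.
under [RHS]eq_bigr do rewrite mulr_sumr.
rewrite exchange_big /=; apply: eq_bigr => y _.
rewrite (bigD1 (y ord0)) //= /walk_prob eqxx mul1r [X in _ + X]big1 ?addr0 // => u.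
by rewrite eq_sym => /negPf ->; rewrite mul0r mulr0.
Qed.

Lemma step_ge0 x y : 0 <= step R G x y.
Proof. by rewrite /step divr_ge0. Qed.

Lemma sum_step x : (0 < deg G x)%N -> \sum_y step R G x y = 1.
Proof.
move=> dx; rewrite /step -mulr_suml -natr_sum -big_mkcond /= sum1dep_card.
by rewrite divff // pnatr_eq0 -lt0n.
Qed.

(** In a typical dense graph two steps lead from anywhere to anywhere with
    comparable probabilities, which is not the case of one step. *)
Definition two_step x z : R := \sum_y step R G x y * step R G y z.

Lemma two_step_ge0 x z : 0 <= two_step x z.
Proof. by apply: sumr_ge0 => y _; rewrite mulr_ge0 ?step_ge0. Qed.

Lemma sum_two_step x : (forall y, 0 < deg G y)%N -> \sum_z two_step x z = 1.
Proof.
move=> d0; rewrite exchange_big /=.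
by under eq_bigr do rewrite -mulr_sumr sum_step // mulr1; exact: sum_step.
Qed.

Lemma two_step_sum (f : V -> R) x :
  \sum_y step R G x y * \sum_z step R G y z * f z = \sum_z two_step x z * f z.
Proof.
under eq_bigr do rewrite mulr_sumr.
rewrite exchange_big /=; apply: eq_bigr => z _.
by rewrite /two_step mulr_suml; apply: eq_bigr => y _; rewrite mulrA.
Qed.

(** A maximum principle.  If x is largest at m, two steps from m reach the zero
    v of x with probability two_step m v, so that
    x m <= 2 a + (1 - two_step m v) * x m.  Summing the resulting bound over all
    possible m makes it independent of x, hence uniform along a sequence of
    functions x; for a = 0 it says that x vanishes. *)
Lemma step_subharmonic_le v (x : V -> R) a :
  (forall y, 0 < deg G y)%N -> (forall w, w != v -> 0 < two_step w v) ->
  0 <= a -> (forall w, 0 <= x w) -> x v = 0 ->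
  (forall w, w != v -> x w <= a + \sum_u step R G w u * x u) ->
  forall w, x w <= \sum_(u | u != v) (2 * a) / two_step u v.
Proof.
move=> d0 p0 a0 x0 xv xle.
have rhs0 (u : V) : u != v -> 0 <= 2 * a / two_step u v.
  by move=> uv; rewrite divr_ge0 ?mulr_ge0 // two_step_ge0.
have x1 w : x w <= a + \sum_u step R G w u * x u.
  have [->|/xle//] := eqVneq w v; rewrite xv addr_ge0 // sumr_ge0 // => u _.
  by rewrite mulr_ge0 ?step_ge0.
have x2 w : x w <= 2 * a + \sum_z two_step w z * x z.
  rewrite (le_trans (x1 w)) // mulr2n mulrDl !mul1r -addrA lerD2l -two_step_sum.
  have {1}-> : a = \sum_u step R G w u * a by rewrite -mulr_suml sum_step // mul1r.
  rewrite -big_split /= ler_sum // => u _.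
  by rewrite -mulrDr ler_wpM2l ?step_ge0.
move=> w.
case: (@arg_maxP _ _ _ w xpredT x isT) => m _ xm.
apply: (le_trans (xm w isT)).
have [->|mv] := eqVneq m v; first by rewrite xv sumr_ge0.
(* The vertex v, where x vanishes, takes no part in the average. *)
have : x m <= 2 * a + (1 - two_step m v) * x m.
  apply: (le_trans (x2 m)); rewrite lerD2l.
  rewrite (bigD1 v) //= xv mulr0 add0r.
  have -> : 1 - two_step m v = \sum_(z | z != v) two_step m z.
    by rewrite -(sum_two_step m d0) (bigD1 v) //= [LHS]addrC addKr.
  rewrite mulr_suml.
  by apply: ler_sum => z _; rewrite ler_wpM2l ?two_step_ge0 //; exact: xm.
rewrite mulrBl mul1r addrCA lerDl subr_ge0 -ler_pdivlMl ?p0 // mulrC => xm2.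
by rewrite (bigD1 m) //= (le_trans xm2) // lerDl sumr_ge0 // => u /andP[uv _]; exact: rhs0.
Qed.

Section Target.
Variable v : V.
Hypothesis deg_gt0 : forall y, (0 < deg G y)%N.
Hypothesis two_step_pos : forall w, w != v -> 0 < two_step w v.

Let hit w t := hit_prob R G w v t.

Lemma hit_prob_ge0 w t : 0 <= hit w t.
Proof.
apply: sumr_ge0 => x _; rewrite mulr_ge0 // prodr_ge0 // => i _.
exact: step_ge0.
Qed.

Definition mass_before w T : R := \sum_(0 <= t < T) hit w t.
Definition moment_before w T : R := \sum_(0 <= t < T) t%:R * hit w t.

Lemma massS w T : mass_before w T.+1 =
  (w == v)%:R + (w != v)%:R * \sum_u step R G w u * mass_before u T.
Proof.
rewrite /mass_before big_nat_recl //= /hit hit_prob0; congr (_ + _).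
under [LHS]eq_bigr do rewrite hit_probS.
rewrite -mulr_sumr exchange_big /=; congr (_ * _).
by apply: eq_bigr => u _; rewrite mulr_sumr.
Qed.

Lemma momentS w T : moment_before w T.+1 =
  (w != v)%:R * \sum_u step R G w u * (moment_before u T + mass_before u T).
Proof.
rewrite /moment_before big_nat_recl //= mul0r add0r.
under [LHS]eq_bigr do rewrite /hit hit_probS mulrCA.
rewrite -mulr_sumr; congr (_ * _).
under [LHS]eq_bigr do rewrite mulr_sumr.
rewrite exchange_big /=; apply: eq_bigr => u _.
rewrite mulrDr !mulr_sumr -big_split /=; apply: eq_bigr => t _.
by rewrite /hit -natr1; ring.
Qed.

Lemma mass_target T : mass_before v T.+1 = 1.
Proof. by rewrite massS eqxx mul0r addr0. Qed.

Lemma moment_target T : moment_before v T = 0.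
Proof.
by case: T => [|T]; rewrite ?momentS ?eqxx ?mul0r // /moment_before big_geq.
Qed.

Lemma moment_ge0 w T : 0 <= moment_before w T.
Proof. by apply: sumr_ge0 => t _; rewrite mulr_ge0 ?hit_prob_ge0. Qed.

Lemma mass_le1 w T : mass_before w T <= 1.
Proof.
elim: T w => [|T IH] w; first by rewrite /mass_before big_geq.
rewrite massS; have [_|_] := eqVneq w v; first by rewrite mul0r addr0.
rewrite mul1r add0r -(sum_step (deg_gt0 w)) ler_sum // => u _.
by rewrite ler_piMr ?step_ge0.
Qed.

Lemma mass_nd w : nondecreasing_seq (mass_before w).
Proof.
apply/nondecreasing_seqP => T.
by rewrite /mass_before big_nat_recr //= lerDl hit_prob_ge0.
Qed.

Lemma moment_nd w : nondecreasing_seq (moment_before w).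
Proof.
apply/nondecreasing_seqP => T.
by rewrite /moment_before big_nat_recr //= lerDl mulr_ge0 ?hit_prob_ge0.
Qed.

(** The truncated moments increase with T, so the recursion for them is an
    inequality between functions at the same T, to which the maximum principle
    applies. *)
Lemma moment_le w T : moment_before w T <= \sum_(u | u != v) (2 * 1) / two_step u v.
Proof.
apply: (step_subharmonic_le (x := moment_before^~ T)) => // [u||{}w wv].
- exact: moment_ge0.
- exact: moment_target.
apply: (le_trans (moment_nd w (leqnSn T))).
rewrite momentS wv mul1r -(sum_step (deg_gt0 w)) -big_split /= ler_sum // => u _.
by rewrite mulrDr [leRHS]addrC lerD2l ler_piMr ?step_ge0 ?mass_le1.
Qed.

Let tau w := lim (mass_before w @ \oo).
Let h w := lim (moment_before w @ \oo).

Lemma mass_cvg w : mass_before w @ \oo --> tau w.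
Proof.
apply: nondecreasing_is_cvgn; first exact: mass_nd.
by exists 1 => _ [T _ <-]; exact: mass_le1.
Qed.

Lemma moment_cvg w : moment_before w @ \oo --> h w.
Proof.
apply: nondecreasing_is_cvgn; first exact: moment_nd.
by eexists => _ [T _ <-]; exact: moment_le.
Qed.

Lemma cvg_step (f : V -> nat -> R) (l : V -> R) w :
  (forall u, f u @ \oo --> l u) ->
  (fun T => \sum_u step R G w u * f u T) @ \oo --> \sum_u step R G w u * l u.
Proof.
move=> fl; apply: cvg_big => [|u _]; first exact: add_continuous.
by apply: cvgMr; exact: fl.
Qed.

(** The probability 1 - tau of never hitting v is harmonic off v and vanishes
    at v. *)
Lemma hit_almost_surely w : tau w = 1.
Proof.
have tauE u : u != v -> tau u = \sum_x step R G u x * tau x.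
  move=> uv; have := @mass_cvg u.
  rewrite -cvg_shiftS.
  under eq_fun do rewrite massS (negPf uv) mul1r add0r.
  by move=> /cvg_unique; apply => //; apply: cvg_step => x; exact: mass_cvg.
have tau_le1 u : tau u <= 1.
  by apply: limr_le; [exact: mass_cvg|near=> T; exact: mass_le1].
have tauv : tau v = 1.
  have := @mass_cvg v; rewrite -cvg_shiftS.
  under eq_fun do rewrite mass_target.
  by move=> /cvg_unique; apply => //; exact: cvg_cst.
have := @step_subharmonic_le v (fun u => 1 - tau u) 0 deg_gt0 two_step_pos.
move=> /(_ (lexx _)) => H.
have : 1 - tau w <= 0.
  apply: (le_trans (H _ _ _ w)) => [u||u uv|].
  - by rewrite subr_ge0.
  - by rewrite tauv subrr.
  - rewrite add0r tauE // -{1}(sum_step (deg_gt0 u)) -sumrB ler_sum // => x _.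
    by rewrite mulrBr mulr1.
  - by rewrite big1 // => u _; rewrite mulr0 mul0r.
by rewrite subr_le0 => t1; apply/eqP; rewrite eq_le tau_le1.
Unshelve. all: by end_near. Qed.

Lemma mean_hit_fin w : mean_hit R G w v = (h w)%:E.
Proof.
have massE : (\sum_(0 <= t <oo) (hit w t)%:E)%E = 1%:E.
  apply/cvg_lim => //; rewrite -(hit_almost_surely w).
  under eq_fun do rewrite sumEFin.
  by apply: cvg_EFin; [near=> T|exact: mass_cvg].
have momE : (\sum_(0 <= t <oo) (t%:R * hit w t)%:E)%E = (h w)%:E.
  apply/cvg_lim => //.
  under eq_fun do rewrite sumEFin.
  by apply: cvg_EFin; [near=> T|exact: moment_cvg].
by rewrite /mean_hit massE momE -EFinB subrr mule0 adde0.
Unshelve. all: by end_near. Qed.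

Lemma mean_hit_system : exists h : V -> R,
  [/\ forall w, mean_hit R G w v = (h w)%:E, h v = 0
    & forall w, w != v -> h w = 1 + \sum_u step R G w u * h u].
Proof.
exists h; split; first exact: mean_hit_fin.
  by rewrite /h (_ : moment_before v = fun=> 0) ?lim_cst //; apply/funext/moment_target.
move=> w wv; have := @moment_cvg w; rewrite -cvg_shiftS.
under eq_fun do rewrite momentS wv mul1r.
move=> /cvg_unique; apply => //.
have -> : 1 + \sum_u step R G w u * h u = \sum_u step R G w u * (h u + tau u).
  rewrite -{1}(sum_step (deg_gt0 w)) -big_split /=; apply: eq_bigr => u _.
  by rewrite hit_almost_surely; ring.
apply: (cvg_step (f := fun u T => moment_before u T + mass_before u T)) => u.
by apply: cvgD; [exact: moment_cvg|exact: mass_cvg].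
Qed.

End Target.
End HittingTimes.

(** * The hitting time equation over two steps *)

Section TwoStepEquation.
Variables (R : realType) (V : finType) (G : sgraph V) (v : V) (h : V -> R).
Hypothesis deg_gt0 : forall y, (0 < deg G y)%N.
Hypothesis hv : h v = 0.
Hypothesis h_eq : forall w, w != v -> h w = 1 + \sum_u step R G w u * h u.

Let N : R := (2 * #|edges G|)%:R / (deg G v)%:R.

Lemma deg_step x y : (deg G x)%:R * step R G x y = (adj G x y)%:R.
Proof. by rewrite /step mulrCA divff ?mulr1 // pnatr_eq0 -lt0n. Qed.

(** The formula of Kac: the mean return time to v is the inverse of its
    stationary mass.  By reversibility the sum of deg w * (h w - (P h) w) over all
    w is zero, and h - P h is 1 at each w <> v. *)
Lemma return_time : 1 + \sum_u step R G v u * h u = N.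
Proof.
have total : \sum_w (deg G w)%:R * \sum_u step R G w u * h u =
             \sum_w (deg G w)%:R * h w.
  under eq_bigr do rewrite mulr_sumr.
  rewrite exchange_big /=; apply: eq_bigr => u _.
  rewrite /deg -sum1dep_card natr_sum mulr_suml [RHS]big_mkcond /=.
  apply: eq_bigr => w _; rewrite mulrA deg_step adjC.
  by case: (adj G u w); rewrite ?mul1r ?mul0r.
have dv : (deg G v)%:R != 0 :> R by rewrite pnatr_eq0 -lt0n.
rewrite /N; apply: (canRL (mulfK dv)).
rewrite mulrDl mul1r -sum_deg natr_sum [RHS](bigD1 v) //=; congr (_ + _); rewrite mulrC.
move: total; rewrite (bigD1 v) //= [RHS](bigD1 v) //= hv mulr0 add0r.
move=> /(canRL (addrK _)) ->.
rewrite -sumrB; apply: eq_bigr => w wv.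
by rewrite {1}h_eq // -mulrBr addrK mulr1.
Qed.

(** By [return_time] the one-step equation holds at v too, with the source
    1 - N instead of 1.  It is iterated once, and the result at v, where h
    vanishes, is subtracted from the result at w.  The equal row sums of two_step
    allow h to be replaced by h - N. *)
Lemma two_step_equation w : w != v ->
  h w - N = - (N * step R G w v) + N * (two_step R G v v - two_step R G w v)
    + \sum_(u | u != v) (two_step R G w u - two_step R G v u) * (h u - N).
Proof.
move=> wv.
have one_step x : h x = 1 - N * (x == v)%:R + \sum_u step R G x u * h u.
  have [->|xv] := eqVneq x v; last by rewrite mulr0 subr0 h_eq.
  by rewrite mulr1 addrAC return_time subrr hv.
have two_steps x : h x = 2 - N * (x == v)%:R - N * step R G x v
                         + \sum_z two_step R G x z * h z.
  rewrite one_step.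
  have -> : \sum_u step R G x u * h u = \sum_u (step R G x u
      - N * (step R G x u * (u == v)%:R)
      + step R G x u * \sum_z step R G u z * h z).
    by apply: eq_bigr => u _; rewrite {1}one_step; ring.
  rewrite !big_split /= sumrN -mulr_sumr sum_step // two_step_sum.
  have -> : \sum_u step R G x u * (u == v)%:R = step R G x v.
    rewrite (bigD1 v) //= eqxx mulr1 big1 ?addr0 // => u /negPf ->.
    by rewrite mulr0.
  by ring.
(* The rows of two_step sum to 1, so N can be subtracted under the sum; the term
   z = v is h v - N = - N. *)
have centre x : \sum_z two_step R G x z * h z =
    N * (1 - two_step R G x v) + \sum_(z | z != v) two_step R G x z * (h z - N).
  rewrite (bigD1 v) //= hv mulr0 add0r.
  have -> : 1 - two_step R G x v = \sum_(z | z != v) two_step R G x z.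
    by rewrite -(sum_two_step R x deg_gt0) (bigD1 v) //= [LHS]addrC addKr.
  by rewrite mulr_sumr -big_split; apply: eq_bigr => z _ /=; ring.
have -> : \sum_(u | u != v) (two_step R G w u - two_step R G v u) * (h u - N) =
    \sum_(u | u != v) two_step R G w u * (h u - N)
    - \sum_(u | u != v) two_step R G v u * (h u - N).
  by rewrite -sumrB; apply: eq_bigr => u _; rewrite mulrBl.
have step_vv : step R G v v = 0 by rewrite /step adjxx mul0r.
have := two_steps w; have := two_steps v.
rewrite !centre hv eqxx (negPf wv) step_vv mulr1 !mulr0 !subr0 => at_v ->.
move: at_v; set A := \sum_(i | _) _; set B := \sum_(i | _) _ => at_v.
by apply/eqP; rewrite -subr_eq0; apply/eqP; rewrite [RHS]at_v; ring.
Qed.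

End TwoStepEquation.

(** * Stability of the limiting block system *)

Lemma card_sbm n : #|sbm_vertex n| = (2 * n)%N.
Proof. by rewrite card_prod card_bool card_ord. Qed.

Lemma sum_community (R : realType) n (f : bool -> R) :
  \sum_(u : sbm_vertex n) f u.1 = n%:R * (f true + f false).
Proof.
rewrite -(pair_bigA _ (fun (b : bool) (_ : 'I_n) => f b)) /= big_bool /=.
by rewrite !sumr_const card_ord -!(mulr_natl (f _)) -mulrDr.
Qed.

Section Stability.
Variables (R : realType) (n : nat) (v : sbm_vertex n) (mu D : R).
Hypothesis n_gt0 : (0 < n)%N.
Variable k : sbm_vertex n -> sbm_vertex n -> R.

(** The limit of n times the difference of the rows w and v of two_step; [mu]
    stands for the square of the second eigenvalue of the walk averaged over the
    communities. *)
Definition block_kernel (w u : sbm_vertex n) : R :=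
  if same_comm w v then 0 else if same_comm u v then - mu else mu.

(** Each community has n vertices, so with this normalization it has weight one
    and the total weight is about two. *)
Definition average_off (x : sbm_vertex n -> R) : R :=
  n%:R^-1 * \sum_(u | u != v) x u.

Hypothesis row_close : forall w, w != v ->
  average_off (fun u => `|k w u - block_kernel w u|) <= D.

Let nV_gt0 : 0 < n%:R^-1 :> R. Proof. by rewrite invr_gt0 ltr0n. Qed.

Lemma average_off_le x y : (forall u, u != v -> x u <= y u) ->
  average_off x <= average_off y.
Proof. by move=> xy; rewrite ler_pM2l // ler_sum. Qed.

Lemma average_offD x y :
  average_off (fun u => x u + y u) = average_off x + average_off y.
Proof. by rewrite /average_off big_split mulrDr. Qed.

Lemma average_offZ c x : average_off (fun u => c * x u) = c * average_off x.
Proof. by rewrite /average_off -mulr_sumr mulrCA. Qed.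

Lemma eq_average_off x y : (forall u, u != v -> x u = y u) ->
  average_off x = average_off y.
Proof. by move=> xy; congr (_ * _); apply: eq_bigr. Qed.

Lemma ler_norm_average x : `|average_off x| <= average_off (fun u => `|x u|).
Proof.
by rewrite normrM gtr0_norm // ler_pM2l // ler_norm_sum.
Qed.

Lemma sum_comm (F : bool -> R) :
  \sum_(u : sbm_vertex n) F (same_comm u v) = n%:R * (F true + F false).
Proof.
rewrite (sum_community n (fun b => F (b == v.1))).
by case: (v.1); rewrite // [F false + _]addrC.
Qed.

Lemma average_comm_le (F : bool -> R) : (forall b, 0 <= F b) ->
  average_off (fun u => F (same_comm u v)) <= F true + F false.
Proof.
move=> F0; have n0 : n%:R != 0 :> R by rewrite pnatr_eq0 -lt0n.
have -> : F true + F false = n%:R^-1 * \sum_(u : sbm_vertex n) F (same_comm u v).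
  by rewrite sum_comm; field.
by rewrite ler_pM2l // [leRHS](bigD1 v) //= lerDr.
Qed.

Lemma replace_kernel (x : sbm_vertex n -> R) X w : w != v ->
  (forall u, u != v -> `|x u| <= X) ->
  `|average_off (fun u => k w u * x u) - average_off (fun u => block_kernel w u * x u)|
     <= D * X.
Proof.
move=> wv xX.
have -> : average_off (fun u => k w u * x u) - average_off (fun u => block_kernel w u * x u)
    = average_off (fun u => (k w u - block_kernel w u) * x u).
  rewrite (eq_average_off (x := fun u => (k w u - _) * _)
    (y := fun u => k w u * x u + (- 1) * (block_kernel w u * x u))); last by move=> u _; ring.
  by rewrite average_offD average_offZ mulN1r.
apply: le_trans (ler_norm_average _) _.
have X0 : 0 <= X by exact: le_trans (xX w wv).
apply: le_trans (_ : X * average_off (fun u => `|k w u - block_kernel w u|) <= _).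
  rewrite -average_offZ; apply: average_off_le => u uv.
  by rewrite normrM mulrC ler_wpM2r // xX.
by rewrite mulrC ler_wpM2r // row_close.
Qed.

(** The weight of the kernel in a row outside the community of v is 2 mu, which
    may exceed 1, so the system is not a contraction.  But the rows of the
    community of v are nearly zero, whence e is at most rho plus a small multiple of
    its maximum there; in the other rows only the weight mu < 1 of the opposite
    community remains multiplied by the maximum of e. *)
Lemma block_stability (e : sbm_vertex n -> R) rho :
  0 <= mu < 1 -> 0 <= D <= (1 - mu) / 4 ->
  (forall w, w != v -> `|e w - average_off (fun u => k w u * e u)| <= rho) ->
  forall w, w != v -> `|e w| <= 4 * rho / (1 - mu).
Proof.
move=> /andP[mu0 mu1] /andP[D0 D1] e_eq w wv.
have [m mv em] := @arg_maxP _ _ _ w (fun u => u != v) (fun u => `|e u|) wv.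
set E := `|e m| in em.
have E0 : 0 <= E by rewrite normr_ge0.
have rho0 : 0 <= rho by exact: le_trans (e_eq w wv).
have block u : u != v ->
    `|e u - average_off (fun z => block_kernel u z * e z)| <= rho + D * E.
  move=> uv; have := e_eq u uv; have := replace_kernel uv em.
  set A := average_off _; set B := average_off _ => AB eA.
  rewrite (_ : e u - B = (e u - A) + (A - B)); last by ring.
  by apply: le_trans (ler_normD _ _) _; exact: lerD.
have same u : u != v -> same_comm u v -> `|e u| <= rho + D * E.
  move=> uv uv_same; have := block u uv.
  rewrite /average_off big1 ?mulr0 ?subr0 // => z _.
  by rewrite /block_kernel uv_same mul0r.
have all u : u != v -> `|e u| <= 2 * (rho + D * E) + mu * E.
  move=> uv.
  have DE0 : 0 <= D * E by rewrite mulr_ge0.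
  have muE : 0 <= mu * E by rewrite mulr_ge0.
  have [uv_same|uv_opp] := boolP (same_comm u v).
    by have := same u uv uv_same; lra.
  have : `|average_off (fun z => block_kernel u z * e z)| <= mu * ((rho + D * E) + E).
    apply: le_trans (ler_norm_average _) _.
    apply: le_trans (_ : average_off (fun z => mu * (if same_comm z v then rho + D * E else E)) <= _).
      apply: average_off_le => z zv; rewrite normrM.
      have -> : `|block_kernel u z| = mu.
        by rewrite /block_kernel (negPf uv_opp); case: ifP; rewrite ?normrN ger0_norm.
      rewrite ler_wpM2l //; case: ifP => [zs|_]; [exact: same|exact: em].
    rewrite average_offZ ler_wpM2l //.
    apply: (average_comm_le (F := fun b => if b then rho + D * E else E)).
    by case; rewrite // addr_ge0.
  have := block u uv; set A := average_off _ => eA A_le.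
  have : `|e u| <= `|e u - A| + `|A| by rewrite -{1}(subrK A (e u)) ler_normD.
  have : mu * (rho + D * E) <= rho + D * E by rewrite ler_piMl ?addr_ge0 // ltW.
  lra.
have Em := all m mv.
apply: (le_trans (em w wv)); rewrite ler_pdivlMr ?subr_gt0 //.
have : 2 * D * E <= (1 - mu) / 2 * E by rewrite ler_wpM2r //; lra.
rewrite -/E in Em *; lra.
Qed.

End Stability.

(** * Transition probabilities of a typical graph *)

Definition codeg (V : finType) (G : sgraph V) (w u : V) : nat :=
  #|[set z | adj G w z & adj G z u]%SET|.

Definition comm_deg n (G : sgraph (sbm_vertex n)) (w : sbm_vertex n) (c : bool) : nat :=
  #|[set u : sbm_vertex n | adj G w u & u.1 == c]%SET|.

Section Rates.
Variables (R : realType) (p q : R).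

Definition rate (b : bool) : R := if b then p else q.
(** The number of common neighbours of two vertices is on average about n times
    this, depending on whether they are in the same community. *)
Definition corate (b : bool) : R := if b then p ^+ 2 + q ^+ 2 else 2 * p * q.

(** To the precision of the theorem, the walk depends on the random graph only
    through its degrees into each community and its numbers of common neighbours. *)
Definition typical n (G : sgraph (sbm_vertex n)) (eta : R) : Prop :=
  (forall w c, `|(comm_deg G w c)%:R - n%:R * rate (w.1 == c)| <= n%:R * eta) /\
  (forall w u, w != u ->
     `|(codeg G w u)%:R - n%:R * corate (same_comm w u)| <= n%:R * eta).

(** A single constant in which all error bounds are expressed; it dominates 1,
    2 / (p + q) and the Lipschitz constant of the inverse of a degree. *)
Definition rate_scale : R := 4 / (p + q) ^+ 2.

Hypotheses (hp : 0 < p < 1) (hq : 0 < q < 1).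
Let a := p + q.

Lemma rate_sum_gt0 : 0 < p + q.
Proof. by move: hp hq => /andP[p0 p1] /andP[q0 q1]; rewrite addr_gt0. Qed.

Lemma rate_sum_lt2 : p + q < 2.
Proof. by move: hp hq; lra. Qed.

Let a_gt0 : 0 < a := rate_sum_gt0.
Let a_lt2 : a < 2 := rate_sum_lt2.

Lemma rate_scale_ge1 : 1 <= rate_scale.
Proof.
rewrite /rate_scale -/a ler_pdivlMr ?exprn_gt0 // mul1r (_ : 4 = 2 ^+ 2); last by ring.
by rewrite ler_sqr ?nnegrE ?ltW.
Qed.

Lemma inv_rate_sum_le : 2 / (p + q) <= rate_scale.
Proof.
rewrite /rate_scale -/a (_ : 4 / _ = (2 / a) * (2 / a)); last by field; rewrite gt_eqF.
by rewrite ler_peMl ?divr_ge0 ?ler_pdivlMr ?mul1r ?ltW.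
Qed.

Lemma corate_ge0 b : 0 <= corate b.
Proof.
move: hp hq => /andP[p0 _] /andP[q0 _].
by case: b; rewrite /= ?addr_ge0 ?exprn_ge0 ?mulr_ge0 ?ltW.
Qed.

Lemma corate_le b : corate b <= (p + q) ^+ 2.
Proof.
move: hp hq => /andP[p0 _] /andP[q0 _].
have pq0 : 0 < p * q by rewrite mulr_gt0.
case: b; rewrite /=; nra.
Qed.

End Rates.

Lemma deg_comm_deg n (G : sgraph (sbm_vertex n)) w :
  deg G w = (comm_deg G w w.1 + comm_deg G w (~~ w.1))%N.
Proof.
rewrite /deg /comm_deg -cardsUI [X in (_ + X)%N]eq_card0 => [|u].
  rewrite addn0; apply: eq_card => u; rewrite !inE.
  by case: (adj G w u) => //=; case: u.1; case: w.1.
by rewrite !inE; case: u.1; case: w.1; rewrite ?andbF.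
Qed.

Section Typical.
Variables (R : realType) (p q : R).
Hypotheses (hp : 0 < p < 1) (hq : 0 < q < 1).
Variables (n : nat) (G : sgraph (sbm_vertex n)) (eta : R).
Hypothesis n_gt0 : (0 < n)%N.
Hypothesis typG : typical p q G eta.

Let a := p + q.
Let K : R := rate_scale p q.
Hypothesis eta_le : eta <= a / 4.

Let a_gt0 : 0 < a := rate_sum_gt0 hp hq.
Let K_ge1 : 1 <= K := rate_scale_ge1 hp hq.
Let K_ge0 : 0 <= K := le_trans ler01 K_ge1.
Let nR_gt0 : 0 < n%:R :> R. Proof. by rewrite ltr0n. Qed.

Let eta_ge0 : 0 <= eta.
Proof.
have := le_trans (normr_ge0 _) (typG.1 (true, Ordinal n_gt0) true).
by rewrite pmulr_rge0.
Qed.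

Lemma deg_approx w : `|(deg G w)%:R - n%:R * a| <= 2 * n%:R * eta.
Proof.
have := typG.1 w w.1; have := typG.1 w (~~ w.1).
rewrite eqxx (_ : (w.1 == ~~ w.1) = false); last by case: w.1.
rewrite deg_comm_deg natrD /rate /a; set x := (comm_deg _ _ _)%:R; set y := (comm_deg _ _ _)%:R.
by rewrite !ler_norml => /andP[? ?] /andP[? ?]; apply/andP; split; lra.
Qed.

Lemma deg_ge w : n%:R * a / 2 <= (deg G w)%:R.
Proof.
have := deg_approx w; rewrite ler_norml => /andP[+ _].
have : n%:R * eta <= n%:R * (a / 4) by rewrite ler_pM2l.
lra.
Qed.

Lemma typical_deg_gt0 w : (0 < deg G w)%N.
Proof.
rewrite -(ltr0n R); apply: lt_le_trans (deg_ge w).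
by rewrite divr_gt0 ?mulr_gt0.
Qed.

Definition inv_deg w : R := n%:R / (deg G w)%:R.

Lemma inv_deg_ge0 w : 0 <= inv_deg w.
Proof. by rewrite divr_ge0. Qed.

Lemma inv_deg_approx w : `|inv_deg w - a^-1| <= K * eta.
Proof.
have d0 : 0 < (deg G w)%:R :> R by rewrite ltr0n typical_deg_gt0.
have -> : inv_deg w - a^-1 =
    (n%:R * a - (deg G w)%:R) * ((deg G w)%:R * a)^-1.
  by rewrite /inv_deg; field; rewrite !gt_eqF.
rewrite normrM distrC (gtr0_norm (x := _^-1)) ?invr_gt0 ?mulr_gt0 //.
rewrite ler_pdivrMr ?mulr_gt0 //; apply: (le_trans (deg_approx w)).
rewrite /K /rate_scale -/a.
have -> : 2 * n%:R * eta = 4 / a ^+ 2 * eta * (n%:R * a / 2 * a).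
  by field; rewrite gt_eqF.
have c0 : 0 <= 4 / a ^+ 2 * eta by rewrite mulr_ge0 ?divr_ge0 ?exprn_ge0 ?(ltW a_gt0).
by rewrite ler_wpM2l // ler_pM2r // deg_ge.
Qed.

Lemma inv_deg_le w : inv_deg w <= K.
Proof.
have d0 : 0 < (deg G w)%:R :> R by rewrite ltr0n typical_deg_gt0.
apply: le_trans (inv_rate_sum_le hp hq); rewrite /inv_deg ler_pdivrMr //.
have := deg_ge w; rewrite -(ler_pM2l (_ : 0 < 2 / a)) ?divr_gt0 //.
by apply: le_trans; rewrite le_eqVlt; apply/orP; left; apply/eqP; field; rewrite gt_eqF.
Qed.

Lemma step_scaled w u : n%:R * step R G w u = (adj G w u)%:R * inv_deg w.
Proof. by rewrite /step /inv_deg; ring. Qed.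

Lemma two_step_scaled w u : n%:R * two_step R G w u =
  inv_deg w * (n%:R^-1 * \sum_(z in [set z | adj G w z & adj G z u]%SET) inv_deg z).
Proof.
rewrite /two_step 2!mulr_sumr [RHS]mulr_sumr [RHS]big_mkcond /=.
apply: eq_bigr => z _; rewrite /step /inv_deg !inE.
have n0 : n%:R != 0 :> R by rewrite gt_eqF.
have d0 x : (deg G x)%:R != 0 :> R by rewrite pnatr_eq0 -lt0n typical_deg_gt0.
case: (adj G w z); case: (adj G z u); rewrite /= ?mul0r ?mulr0 //.
by field; rewrite !d0 n0.
Qed.

Lemma sum_inv_deg_approx (S : {set sbm_vertex n}) :
  `|n%:R^-1 * (\sum_(z in S) inv_deg z) - #|S|%:R / n%:R / a| <= 2 * K * eta.
Proof.
have -> : n%:R^-1 * (\sum_(z in S) inv_deg z) - #|S|%:R / n%:R / a =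
    n%:R^-1 * \sum_(z in S) (inv_deg z - a^-1).
  rewrite sumrB sumr_const -[a^-1 *+ _]mulr_natr.
  by field; rewrite !gt_eqF.
rewrite normrM gtr0_norm ?invr_gt0 // mulrC ler_pdivrMr //.
apply: le_trans (ler_norm_sum _ _ _) _.
apply: (@le_trans _ _ (\sum_(z in S) K * eta)).
  by apply: ler_sum => z _; exact: inv_deg_approx.
rewrite sumr_const -[leLHS]mulr_natr.
have -> : 2 * K * eta * n%:R = K * eta * (2 * n)%:R by rewrite natrM; ring.
rewrite ler_wpM2l ?(mulr_ge0 K_ge0) // ler_nat -card_sbm.
exact: max_card.
Qed.

Lemma two_step_scaled_le w u : n%:R * two_step R G w u <= 2 * K ^+ 2.
Proof.
rewrite two_step_scaled (_ : 2 * _ = K * (2 * K)); last by ring.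
rewrite ler_pM ?inv_deg_ge0 ?inv_deg_le //.
  by rewrite mulr_ge0 ?invr_ge0 // sumr_ge0 // => z _; exact: inv_deg_ge0.
rewrite mulrC ler_pdivrMr //.
apply: (@le_trans _ _ (\sum_(z : sbm_vertex n) K)).
  rewrite big_mkcond /= ler_sum // => z _; case: ifP => _; first exact: inv_deg_le.
  exact: le_trans K_ge1.
by rewrite sumr_const -[leLHS]mulr_natr card_sbm natrM le_eqVlt; apply/orP; left; apply/eqP; ring.
Qed.

(** Here the sum runs over all neighbours of w and their number cancels against
    the degree of w, so that no codegree enters. *)
Lemma two_step_diag w : `|n%:R * two_step R G w w - a^-1| <= 2 * K ^+ 2 * eta.
Proof.
rewrite two_step_scaled; set S := [set _ | _]%SET.
have cS : #|S| = deg G w by apply: eq_card => z; rewrite !inE [adj G z w]adjC andbb.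
have := sum_inv_deg_approx S; rewrite cS; set X := n%:R^-1 * _ => HX.
have d0 : (deg G w)%:R != 0 :> R by rewrite pnatr_eq0 -lt0n typical_deg_gt0.
have -> : inv_deg w * X - a^-1 = inv_deg w * (X - (deg G w)%:R / n%:R / a).
  rewrite mulrBr; congr (_ - _); rewrite /inv_deg; field.
  by rewrite d0 !gt_eqF.
rewrite normrM ger0_norm ?inv_deg_ge0 //.
rewrite (_ : 2 * _ * _ = K * (2 * K * eta)); last by ring.
by rewrite ler_pM ?inv_deg_ge0 ?inv_deg_le.
Qed.

(** Up to the fluctuation of degrees, n * two_step w u is the number of common
    neighbours divided by n * a ^+ 2. *)
Lemma two_step_offdiag w u : w != u ->
  `|n%:R * two_step R G w u - corate p q (same_comm w u) / a ^+ 2| <= 5 * K ^+ 2 * eta.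
Proof.
move=> wu; rewrite two_step_scaled; set S := [set _ | _]%SET.
have := sum_inv_deg_approx S; have := typG.2 w u wu.
rewrite (_ : codeg G w u = #|S|) //; set s := #|S|%:R.
set X := n%:R^-1 * _; set k := corate _ _ _ => Hs HX.
have Hs' : `|s / n%:R / a - k / a| <= K * eta.
  have -> : s / n%:R / a - k / a = (s - n%:R * k) * (n%:R * a)^-1.
    by field; rewrite !gt_eqF.
  rewrite normrM (gtr0_norm (x := _^-1)) ?invr_gt0 ?mulr_gt0 //.
  rewrite ler_pdivrMr ?mulr_gt0 //; apply: (le_trans Hs).
  rewrite (_ : K * eta * _ = (K * a) * (n%:R * eta)); last by ring.
  rewrite ler_peMl ?mulr_ge0 //.
  rewrite (le_trans _ (_ : 2 <= _)) ?ler1n //.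
  by rewrite -ler_pdivrMr //; exact: inv_rate_sum_le.
have HXk : `|X - k / a| <= 3 * K * eta.
  rewrite (_ : X - k / a = (X - s / n%:R / a) + (s / n%:R / a - k / a)); last by ring.
  apply: le_trans (ler_normD _ _) _; lra.
have -> : inv_deg w * X - k / a ^+ 2 =
    inv_deg w * (X - k / a) + (inv_deg w - a^-1) * (k / a).
  by field; rewrite gt_eqF.
apply: le_trans (ler_normD _ _) _.
rewrite (normrM (inv_deg w)) (normrM (_ - _)) (ger0_norm (inv_deg_ge0 w)).
have k_le : `|k / a| <= 2.
  rewrite ger0_norm ?(divr_ge0 (corate_ge0 hp hq _) (ltW a_gt0)) //.
  by rewrite ler_pdivrMr // (le_trans (corate_le hp hq _)) // expr2 ler_pM2r // ltW //; exact: rate_sum_lt2.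
have := ler_pM (inv_deg_ge0 w) (normr_ge0 _) (inv_deg_le w) HXk.
have := ler_pM (normr_ge0 _) (normr_ge0 _) (inv_deg_approx w) k_le.
have : K * eta <= K ^+ 2 * eta.
  by rewrite ler_wpM2r // expr2 ler_peMl // (le_trans _ K_ge1).
lra.
Qed.

Lemma stationary_inv_approx v :
  `|(2 * #|edges G|)%:R / (deg G v)%:R / n%:R - 2| <= 8 * K * eta.
Proof.
rewrite -sum_deg natr_sum.
have nn : n%:R != 0 :> R by rewrite gt_eqF.
set D := \sum_w _; have -> : D / (deg G v)%:R / n%:R = D / n%:R ^+ 2 * inv_deg v.
  by rewrite /inv_deg; field; rewrite nn pnatr_eq0 -lt0n typical_deg_gt0.
have HD : `|D / n%:R ^+ 2 - 2 * a| <= 4 * eta.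
  have -> : D / n%:R ^+ 2 - 2 * a =
      (\sum_(w : sbm_vertex n) ((deg G w)%:R - n%:R * a)) / n%:R ^+ 2.
    rewrite sumrB -/D sumr_const card_sbm -[_ *+ (2 * n)]mulr_natr natrM.
    by field.
  rewrite normrM (gtr0_norm (x := _^-1)) ?invr_gt0 ?exprn_gt0 //.
  rewrite ler_pdivrMr ?exprn_gt0 //.
  apply: le_trans (ler_norm_sum _ _ _) _.
  apply: (@le_trans _ _ (\sum_(w : sbm_vertex n) 2 * n%:R * eta)).
    by apply: ler_sum => w _; exact: deg_approx.
  rewrite sumr_const card_sbm -[leLHS]mulr_natr natrM.
  by rewrite le_eqVlt; apply/orP; left; apply/eqP; ring.
have -> : D / n%:R ^+ 2 * inv_deg v - 2 =
    (D / n%:R ^+ 2 - 2 * a) * inv_deg v + (2 * a) * (inv_deg v - a^-1).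
  by field; rewrite nn gt_eqF.
apply: le_trans (ler_normD _ _) _.
rewrite (normrM _ (inv_deg v)) (normrM (2 * a)) (ger0_norm (inv_deg_ge0 v)).
have := ler_pM (normr_ge0 _) (inv_deg_ge0 v) HD (inv_deg_le v).
have a4 : `|2 * a| <= 4.
  by rewrite ger0_norm ?mulr_ge0 ?(ltW a_gt0) //; move: (rate_sum_lt2 hp hq); rewrite -/a; lra.
have := ler_pM (normr_ge0 _) (normr_ge0 _) a4 (inv_deg_approx v).
lra.
Qed.

End Typical.

(** * Hitting times on a typical graph *)

Section Correction.
Variables (R : realType) (p q : R).
Hypotheses (hp : 0 < p < 1) (hq : 0 < q < 1).
Let a := p + q.
Let K := rate_scale p q.

(** The second eigenvalue of the two-state walk between communities is
    (p - q) / (p + q). *)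
Definition eig_sq : R := (q - p) ^+ 2 / (p + q) ^+ 2.

Definition comm_term (same : bool) : R :=
  if same then - ((q - p) ^+ 2 / (p + q) ^+ 2)
  else p * (q - p) ^+ 2 / (q * (p + q) ^+ 2).

(** The claimed value of h w - N. *)
Definition correction n (G : sgraph (sbm_vertex n)) (v w : sbm_vertex n) : R :=
  2 / (p + q) * (~~ adj G w v)%:R - 1 + comm_term (same_comm w v).

Let a_gt0 : 0 < a := rate_sum_gt0 hp hq.
Let K_ge1 : 1 <= K := rate_scale_ge1 hp hq.
Let q_gt0 : 0 < q. Proof. by case/andP: hq. Qed.
Let p_gt0 : 0 < p. Proof. by case/andP: hp. Qed.

Lemma eig_sq_ge0 : 0 <= eig_sq.
Proof. by rewrite divr_ge0 ?sqr_ge0. Qed.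

Lemma one_sub_eig_sq : 1 - eig_sq = 4 * p * q / (p + q) ^+ 2.
Proof. by rewrite /eig_sq; field; rewrite gt_eqF. Qed.

Lemma eig_sq_lt1 : eig_sq < 1.
Proof. by rewrite -subr_gt0 one_sub_eig_sq divr_gt0 ?mulr_gt0 ?exprn_gt0. Qed.

Lemma comm_term_true : comm_term true = - eig_sq.
Proof. by []. Qed.

Lemma comm_term_false : comm_term false = p / q * eig_sq.
Proof. by rewrite /comm_term /eig_sq; field; rewrite !gt_eqF. Qed.

Lemma comm_term_norm b : `|comm_term b| <= 1 + p / q.
Proof.
have pq0 : 0 <= p / q by rewrite divr_ge0 ?ltW.
have := eig_sq_ge0; have := eig_sq_lt1.
case: b; rewrite ?comm_term_true ?comm_term_false => g1 g0.
  by rewrite normrN ger0_norm //; lra.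
rewrite ger0_norm ?(mulr_ge0 pq0 g0) //.
have : p / q * eig_sq <= p / q by rewrite ler_piMr // ltW.
lra.
Qed.

Lemma correction_norm n (G : sgraph (sbm_vertex n)) v w :
  `|correction G v w| <= K + 2 + p / q.
Proof.
rewrite /correction.
have := comm_term_norm (same_comm w v); set c := comm_term _ => c_le.
have : `|2 / (p + q) * (~~ adj G w v)%:R| <= K.
  have al0 : 0 <= 2 / (p + q) by rewrite divr_ge0 // ltW.
  rewrite ger0_norm ?(mulr_ge0 al0) //.
  case: (adj G w v); rewrite /= ?mulr0 ?mulr1; first exact: le_trans K_ge1.
  exact: inv_rate_sum_le.
set t := 2 / (p + q) * _ => t_le.
apply: le_trans (ler_normD _ _) _.
by have := ler_normB t 1; rewrite normr1; lra.
Qed.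

End Correction.

Section Deterministic.
Variables (R : realType) (p q : R).
Hypotheses (hp : 0 < p < 1) (hq : 0 < q < 1).
Variables (n : nat) (G : sgraph (sbm_vertex n)) (eta : R) (v : sbm_vertex n).
Hypothesis n_gt0 : (0 < n)%N.
Hypothesis typG : typical p q G eta.
Let a := p + q.
Let K : R := rate_scale p q.
Let mu : R := eig_sq p q.
Hypothesis eta_le : eta <= a / 4.
Hypothesis eta_small : 8 * K * eta <= 1.
Hypothesis n_eta : n%:R^-1 <= eta.

Let a_gt0 : 0 < a := rate_sum_gt0 hp hq.
Let K_ge1 : 1 <= K := rate_scale_ge1 hp hq.
Let K_ge0 : 0 <= K := le_trans ler01 K_ge1.
Let nR_gt0 : 0 < n%:R :> R. Proof. by rewrite ltr0n. Qed.
Let eta_ge0 : 0 <= eta.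
Proof. by apply: le_trans n_eta; rewrite invr_ge0. Qed.
Let q_gt0 : 0 < q. Proof. by case/andP: hq. Qed.
Let p_gt0 : 0 < p. Proof. by case/andP: hp. Qed.
Let K2_ge0 : 0 <= K ^+ 2. Proof. exact: exprn_ge0. Qed.
Let K2_ge1 : 1 <= K ^+ 2. Proof. by rewrite exprn_ege1. Qed.

Definition diff_kernel (w u : sbm_vertex n) : R :=
  n%:R * (two_step R G w u - two_step R G v u).

Lemma diff_kernel_offdiag w u : w != v -> u != v -> u != w ->
  `|diff_kernel w u - block_kernel v mu w u| <= 10 * K ^+ 2 * eta.
Proof.
move=> wv uv uw.
have wu : w != u by rewrite eq_sym.
have vu : v != u by rewrite eq_sym.
have := two_step_offdiag hp hq n_gt0 typG eta_le wu.
have := two_step_offdiag hp hq n_gt0 typG eta_le vu.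
have -> : block_kernel v mu w u = corate p q (same_comm w u) / a ^+ 2
                                  - corate p q (same_comm v u) / a ^+ 2.
  have -> : mu = corate p q true / a ^+ 2 - corate p q false / a ^+ 2.
    by rewrite /mu /eig_sq /= -/a; field; rewrite gt_eqF.
  rewrite /block_kernel /same_comm; case: (w.1); case: (v.1); case: (u.1) => /=; ring.
rewrite /diff_kernel -/a -/K mulrBr.
set x := _ * two_step _ _ _ _; set y := _ * two_step _ _ _ _.
set c := _ / _; set d := _ / _ => vB wB.
rewrite (_ : _ - _ = (y - d) - (x - c)); last by ring.
by apply: le_trans (ler_normB _ _) _; lra.
Qed.

(** For u = w the return probability two_step w w enters, which is not of the
    generic size.  A crude bound suffices, since this is one term of an average. *)
Lemma diff_kernel_diag w : `|diff_kernel w w - block_kernel v mu w w| <= 3 * K ^+ 2.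
Proof.
have K0 := two_step_scaled_le hp hq n_gt0 typG eta_le.
have P0 x y : 0 <= n%:R * two_step R G x y by rewrite mulr_ge0 ?two_step_ge0.
have bk : `|block_kernel v mu w w| <= 1.
  have := eig_sq_ge0 p q; have := eig_sq_lt1 hp hq; rewrite -/mu => m1 m0.
  by rewrite /block_kernel; case: (same_comm w v); rewrite ?normr0 // ger0_norm // ltW.
have kw : `|diff_kernel w w| <= 2 * K ^+ 2.
  rewrite /diff_kernel mulrBr ler_norml.
  have := K0 w w; have := K0 v w; have := P0 w w; have := P0 v w.
  by rewrite -/K => *; apply/andP; split; lra.
by apply: le_trans (ler_normB _ _) _; have := K2_ge1; lra.
Qed.

Lemma average_off_pred1 w c : w != v ->
  average_off v (fun u => (u == w)%:R * c) = n%:R^-1 * c :> R.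
Proof.
move=> wv; rewrite /average_off (bigD1 w) //= eqxx mul1r big1 ?addr0 //.
by move=> u /andP[_ /negPf ->]; rewrite mul0r.
Qed.

(** Each of the two communities contributes 10 * K ^+ 2 * eta; the term u = w
    has the weight 1 / n <= eta. *)
Lemma diff_kernel_row w : w != v ->
  average_off v (fun u => `|diff_kernel w u - block_kernel v mu w u|) <= 23 * K ^+ 2 * eta.
Proof.
move=> wv; have c0 : 0 <= 10 * K ^+ 2 * eta by apply: mulr_ge0; rewrite // mulr_ge0.
apply: le_trans (_ : average_off v (fun u => 10 * K ^+ 2 * eta
   + (u == w)%:R * (3 * K ^+ 2)) <= _).
  apply: average_off_le => // u uv.
  have [->|uw] := eqVneq u w; rewrite ?mul1r ?mul0r ?addr0.
    by apply: le_trans (diff_kernel_diag w) _; rewrite lerDr.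
  exact: diff_kernel_offdiag.
rewrite average_offD average_off_pred1 //.
have := average_comm_le v n_gt0 (F := fun=> 10 * K ^+ 2 * eta).
move=> /(_ (fun=> c0)) F_le.
have : n%:R^-1 * (3 * K ^+ 2) <= eta * (3 * K ^+ 2).
  by rewrite ler_wpM2r // mulr_ge0.
lra.
Qed.

Let N : R := (2 * #|edges G|)%:R / (deg G v)%:R.

(** The explicit terms in [two_step_equation]. *)
Definition source (w : sbm_vertex n) : R :=
  - (N * step R G w v) + N * (two_step R G v v - two_step R G w v).

Definition source_limit (w : sbm_vertex n) : R :=
  2 * (- ((adj G w v)%:R / a) + a^-1 - corate p q (same_comm w v) / a ^+ 2).

(** The transition probabilities times n, and N / n, are close to constants, the
    latter to 2. *)
Lemma source_approx w : w != v ->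
  `|source w - source_limit w| <= 32 * K ^+ 2 * eta.
Proof.
move=> wv.
have n0 : n%:R != 0 :> R by rewrite gt_eqF.
pose M := N / n%:R.
have HM : `|M - 2| <= 8 * K * eta := stationary_inv_approx hp hq n_gt0 typG eta_le v.
have M3 : `|M| <= 3.
  by rewrite -(subrK 2 M); apply: le_trans (ler_normD _ _) _; rewrite (ger0_norm (x := 2)) //; have := eta_small; lra.
pose Y := - (n%:R * step R G w v) + n%:R * two_step R G v v - n%:R * two_step R G w v.
pose Y0 := - ((adj G w v)%:R / a) + a^-1 - corate p q (same_comm w v) / a ^+ 2.
have -> : source w - source_limit w = M * (Y - Y0) + (M - 2) * Y0.
  by rewrite /source /source_limit -/Y0 /M /Y; field.
have HY : `|Y - Y0| <= 8 * K ^+ 2 * eta.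
  have := two_step_offdiag hp hq n_gt0 typG eta_le wv.
  have := two_step_diag hp hq n_gt0 typG eta_le v.
  have : `|n%:R * step R G w v - (adj G w v)%:R / a| <= K ^+ 2 * eta.
    rewrite step_scaled -mulrBr normrM.
    have := inv_deg_approx hp hq n_gt0 typG eta_le w; rewrite -/a -/K => Hd.
    case: (adj G w v); rewrite ?normr1 ?normr0 ?mul1r ?mul0r; last exact: mulr_ge0.
    by apply: le_trans Hd _; rewrite ler_wpM2r // expr2 ler_peMl.
  rewrite -/a -/K /Y /Y0 !ler_norml.
  by move=> /andP[? ?] /andP[? ?] /andP[? ?]; apply/andP; split; lra.
have HY0 : `|Y0| <= K.
  have k0 : 0 <= corate p q (same_comm w v) / a ^+ 2.
    by rewrite divr_ge0 ?corate_ge0 ?exprn_ge0 ?(ltW a_gt0).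
  have k1 : corate p q (same_comm w v) / a ^+ 2 <= 1.
    by rewrite ler_pdivrMr ?exprn_gt0 // mul1r corate_le.
  have ia : 0 <= a^-1 by rewrite invr_ge0 ltW.
  have iaK : a^-1 + a^-1 <= K by have := inv_rate_sum_le hp hq; rewrite -/a -/K; lra.
  rewrite /Y0 ler_norml; move: k0 k1; set k := corate _ _ _ / _ => k0 k1.
  by case: (adj G w v); rewrite /= ?mul1r ?mul0r; apply/andP; have := K_ge1; split; lra.
apply: le_trans (ler_normD _ _) _; rewrite (normrM M) (normrM (M - 2)).
have := ler_pM (normr_ge0 _) (normr_ge0 _) M3 HY.
have := ler_pM (normr_ge0 _) (normr_ge0 _) HM HY0.
lra.
Qed.

(** The limit of the kernel applied to the correction, in a row outside the
    community of v: the difference between the averages of the correction over the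
    two communities, times mu. *)
Definition average_correction : R :=
  mu * (comm_term p q false - comm_term p q true + 2 / a * (p - q)).

(** The correction is the exact solution of the limiting system; this is the
    computation that produces the constants of the theorem. *)
Lemma correction_block w : source_limit w +
  (if same_comm w v then 0 else average_correction) = correction p q G v w.
Proof.
have a0 : a != 0 by rewrite gt_eqF.
have q0 : q != 0 by rewrite gt_eqF.
rewrite /source_limit /correction /average_correction /comm_term /mu /eig_sq.
by case: (same_comm w v); case: (adj G w v) => /=; rewrite -/a /a; field;
  rewrite -/a ?a0 ?q0.
Qed.

Lemma signed_comm_deg : \sum_(u : sbm_vertex n)
    (if same_comm u v then -1 else 1) * (adj G u v)%:R =
  (comm_deg G v (~~ v.1))%:R - (comm_deg G v v.1)%:R :> R.
Proof.
rewrite /comm_deg -!sum1dep_card !natr_sum.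
rewrite [X in _ = X - _]big_mkcond [X in _ = _ - X]big_mkcond /= -sumrB.
apply: eq_bigr => u _; rewrite adjC /same_comm.
by case: (adj G v u); case: u.1; case: v.1; rewrite /= ?mulr0 ?mulr1 ?subr0 ?sub0r ?subrr.
Qed.

(** The averages of the correction involve the adjacency to v only through the
    numbers of neighbours of v in each community. *)
Lemma average_correction_approx w : w != v -> ~~ same_comm w v ->
  `|average_off v (fun u => block_kernel v mu w u * correction p q G v u)
    - average_correction| <= (2 * K + (K + 2 + p / q)) * eta.
Proof.
move=> wv wv_opp.
have n0 : n%:R != 0 :> R by rewrite gt_eqF.
pose al := 2 / a.
pose c b := al - 1 + comm_term p q b.
have corrE u : correction p q G v u = c (same_comm u v) - al * (adj G u v)%:R.
  rewrite /correction -/a -/al /c; case: (adj G u v) => /=; ring.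
pose sg (b : bool) : R := if b then -1 else 1.
have total : \sum_u sg (same_comm u v) * correction p q G v u =
    n%:R * (c false - c true)
    - al * ((comm_deg G v (~~ v.1))%:R - (comm_deg G v v.1)%:R).
  rewrite -signed_comm_deg mulr_sumr.
  have -> : n%:R * (c false - c true) = \sum_(u : sbm_vertex n)
      sg (same_comm u v) * c (same_comm u v).
    by rewrite (sum_comm v (fun b => sg b * c b)) /sg; ring.
  by rewrite -sumrB; apply: eq_bigr => u _; rewrite corrE /sg; ring.
have -> : average_off v (fun u => block_kernel v mu w u * correction p q G v u) =
    mu * (c false - c true
      - al * ((comm_deg G v (~~ v.1))%:R - (comm_deg G v v.1)%:R) / n%:R
      + correction p q G v v / n%:R).
  rewrite -[X in _ = mu * X](_ : n%:R^-1 * \sum_(u | u != v)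
    sg (same_comm u v) * correction p q G v u = _).
    rewrite -/(average_off v _) -average_offZ; apply: eq_average_off => u uv.
    by rewrite /block_kernel (negPf wv_opp) /sg; case: ifP => _; ring.
  move: total; rewrite (bigD1 v) //= {1}/same_comm eqxx /sg mulN1r.
  move=> /(canRL (addKr _)) ->; rewrite opprK.
  by field.
have := typG.1 v v.1; have := typG.1 v (~~ v.1).
rewrite eqxx (_ : (v.1 == ~~ v.1) = false); last by case: v.1.
rewrite /rate /=; set x := (comm_deg _ _ _)%:R; set y := (comm_deg _ _ _)%:R => Hx Hy.
have := correction_norm hp hq G v v; set g := correction _ _ _ _ _ => g_le.
have mu0 : 0 <= mu := eig_sq_ge0 p q.
have mu1 : mu < 1 := eig_sq_lt1 hp hq.
have -> : mu * (c false - c true - al * (x - y) / n%:R + g / n%:R) - average_correction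
   = mu * (al * ((y - n%:R * p) - (x - n%:R * q)) / n%:R + g / n%:R).
  by rewrite /average_correction /c -/al; field.
rewrite normrM (ger0_norm mu0).
rewrite -[leRHS]mul1r ler_pM ?(ltW mu1) //.
apply: le_trans (ler_normD _ _) _; rewrite [leRHS]mulrDl lerD //.
  rewrite normrM (gtr0_norm (x := _^-1)) ?invr_gt0 // ler_pdivrMr // normrM.
  have alK : `|al| <= K.
    by rewrite ger0_norm ?divr_ge0 ?(ltW a_gt0) //; exact: inv_rate_sum_le.
  rewrite (_ : 2 * K * eta * n%:R = K * (n%:R * eta + n%:R * eta)); last by ring.
  rewrite ler_pM //; apply: le_trans (ler_normB _ _) _; exact: lerD.
by rewrite normrM ler_pM // gtr0_norm ?invr_gt0.
Qed.

Let Gam : R := K + 2 + p / q.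

(** Three errors are added: in the source, in the kernel, and in the averages of
    the correction over the communities. *)
Lemma correction_consistent w : w != v ->
  `|source w + average_off v (fun u => diff_kernel w u * correction p q G v u)
    - correction p q G v w| <= (32 * K ^+ 2 + 23 * K ^+ 2 * Gam + (2 * K + Gam)) * eta.
Proof.
move=> wv.
have := source_approx wv.
have := replace_kernel n_gt0 diff_kernel_row wv (fun u _ => correction_norm hp hq G v u).
rewrite -/Gam -/K -(correction_block w).
set S := source w; set S0 := source_limit w; set A := average_off _ _.
set B := average_off _ _ => AB SS.
have pq0 : 0 <= p / q by rewrite divr_ge0 // ltW.
have Gam0 : 0 <= Gam by rewrite addr_ge0 // addr_ge0.
have : `|B - (if same_comm w v then 0 else average_correction)| <= (2 * K + Gam) * eta.
  have [wv_same|wv_opp] := boolP (same_comm w v); last exact: average_correction_approx.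
  rewrite /B /average_off big1 ?mulr0 ?subrr ?normr0; last first.
    by move=> u _; rewrite /block_kernel wv_same mul0r.
  by apply: mulr_ge0 => //; rewrite addr_ge0 // mulr_ge0.
set Z := (if _ then _ else _) => BZ.
rewrite (_ : _ - _ = (S - S0) + (A - B) + (B - Z)); last by ring.
apply: le_trans (ler_normD _ _) _.
have := ler_normD (S - S0) (A - B); lra.
Qed.

Hypothesis eta_stable : 23 * K ^+ 2 * eta <= (1 - mu) / 4.

Lemma two_step_typical_gt0 w : w != v -> 0 < two_step R G w v.
Proof.
move=> wv; rewrite -(pmulr_rgt0 _ nR_gt0).
have := two_step_offdiag hp hq n_gt0 typG eta_le wv.
rewrite -/a -/K ler_norml => /andP[+ _].
have : (1 - mu) / 2 <= corate p q (same_comm w v) / a ^+ 2.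
  rewrite /mu (one_sub_eig_sq hp hq) -/a ler_pdivlMr ?exprn_gt0 //.
  rewrite [leLHS](_ : _ = 2 * p * q); last by field; rewrite gt_eqF.
  case: (same_comm w v) => //=; have := sqr_ge0 (p - q); nra.
set k := corate _ _ _ / _ => k_ge.
have m1 : 0 < 1 - mu by rewrite subr_gt0; exact: eig_sq_lt1.
have : 5 * K ^+ 2 * eta <= 23 * K ^+ 2 * eta.
  by rewrite ler_wpM2r // ler_wpM2r // ler_nat.
by have := eta_stable; lra.
Qed.

(** The difference e of h - N and the correction solves the two-step system with
    the residual of [correction_consistent] as its source. *)
Lemma hitting_time_expansion (h : sbm_vertex n -> R) : h v = 0 ->
  (forall w, w != v -> h w = 1 + \sum_u step R G w u * h u) ->
  forall w, w != v -> `|h w - (N + correction p q G v w)|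
    <= 4 * ((32 * K ^+ 2 + 23 * K ^+ 2 * Gam + (2 * K + Gam)) * eta) / (1 - mu).
Proof.
move=> hv h_eq w wv.
rewrite opprD addrA.
apply: (block_stability n_gt0 diff_kernel_row (e := fun u => h u - N - correction p q G v u)) => //.
- by rewrite eig_sq_ge0 eig_sq_lt1.
- by rewrite eta_stable andbT mulr_ge0 ?eta_ge0 // mulr_ge0 ?K2_ge0.
move=> {w wv} w wv.
have deg_gt0 := typical_deg_gt0 hp hq n_gt0 typG eta_le.
have -> : h w - N - correction p q G v w
    - average_off v (fun u => diff_kernel w u * (h u - N - correction p q G v u)) =
  source w + average_off v (fun u => diff_kernel w u * correction p q G v u)
    - correction p q G v w.
  rewrite (two_step_equation deg_gt0 hv h_eq wv) -/N -/(source w).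
  have -> : \sum_(u | u != v) (two_step R G w u - two_step R G v u) * (h u - N) =
      average_off v (fun u => diff_kernel w u * (h u - N)).
    rewrite /average_off mulr_sumr; apply: eq_bigr => u _.
    by rewrite /diff_kernel; field; rewrite gt_eqF.
  rewrite (eq_average_off (x := fun u => diff_kernel w u * (h u - N - _))
    (y := fun u => diff_kernel w u * (h u - N) + -1 * (diff_kernel w u * correction p q G v u))).
    by rewrite average_offD average_offZ; ring.
  by move=> u _; ring.
exact: correction_consistent.
Qed.

End Deterministic.

(** The threshold e0 is the smallest of the bounds on eta used above: degrees at
    least half their mean, 2|E| / deg v at most 3 n, and stability of the block
    system. *)
Lemma typical_mean_hit (R : realType) (p q : R) : 0 < p < 1 -> 0 < q < 1 ->
  exists C e0 : R, [/\ 0 <= C, 0 < e0 & forall n (G : sgraph (sbm_vertex n)) eta,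
    (0 < n)%N -> n%:R^-1 <= eta -> eta <= e0 -> typical p q G eta ->
    forall w v : sbm_vertex n, w != v ->
    (`| mean_hit R G w v
        - ((2 * #|edges G|)%:R / (deg G v)%:R - 1
           + 2 / (p + q) * (~~ adj G w v)%:R + comm_term p q (same_comm w v))%R%:E |
     <= (C * eta)%R%:E)%E].
Proof.
move=> hp hq.
pose K := rate_scale p q; pose Gam := K + 2 + p / q; pose mu := eig_sq p q.
have K1 : 1 <= K := rate_scale_ge1 hp hq.
have K0 : 0 <= K by exact: le_trans K1.
have m1 : 0 < 1 - mu by rewrite subr_gt0; exact: eig_sq_lt1.
have a0 := rate_sum_gt0 hp hq.
have K20 : 0 < K ^+ 2 by rewrite exprn_gt0 // (lt_le_trans _ K1).
have pq0 : 0 <= p / q.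
  by case/andP: hp hq => /ltW ? _ /andP[/ltW ? _]; exact: divr_ge0.
have Gam0 : 0 <= Gam by rewrite addr_ge0 // addr_ge0.
pose C := 4 * (32 * K ^+ 2 + 23 * K ^+ 2 * Gam + (2 * K + Gam)) / (1 - mu).
pose e0 := Order.min ((p + q) / 4) (Order.min (8 * K)^-1 ((1 - mu) / (92 * K ^+ 2))).
exists C, e0; split.
- apply: divr_ge0 (ltW m1); apply: mulr_ge0 => //.
  apply: addr_ge0; last by rewrite addr_ge0 // mulr_ge0.
  by apply: addr_ge0; rewrite ?(mulr_ge0 _ Gam0) // mulr_ge0 // ltW.
- rewrite /e0 !lt_min; apply/and3P; split; first exact: divr_gt0.
    by rewrite invr_gt0 mulr_gt0 // (lt_le_trans _ K1).
  by apply: divr_gt0 => //; exact: mulr_gt0.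
move=> n G eta n0 n_eta.
rewrite /e0 !le_min => /and3P[eta_a eta_K eta_m] typ w v wv.
have K8 : 8 * K * eta <= 1.
  have K8_gt0 : 0 < 8 * K by rewrite mulr_gt0 // (lt_le_trans _ K1).
  by rewrite -ler_pdivlMl // mulr1.
have stableK : 23 * K ^+ 2 * eta <= (1 - mu) / 4.
  rewrite (_ : (1 - mu) / 4 = 23 * K ^+ 2 * ((1 - mu) / (92 * K ^+ 2))).
    by rewrite ler_pM2l // mulr_gt0.
  by field; rewrite gt_eqF // (lt_le_trans _ K1).
have [h [hE hv h_eq]] := mean_hit_system (typical_deg_gt0 hp hq n0 typ eta_a)
  (fun w => @two_step_typical_gt0 R p q hp hq n G eta v n0 typ eta_a n_eta stableK w).
rewrite hE -EFinB abse_EFin lee_fin.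
have := hitting_time_expansion hp hq n0 typ eta_a K8 n_eta stableK hv h_eq wv.
rewrite -/K -/Gam -/mu.
rewrite (_ : 4 * _ / _ = C * eta); last by rewrite /C; ring.
by congr (`|_| <= _); rewrite /correction; ring.
Qed.

(** * Concentration for independent Bernoulli variables *)

Section ProductLaw.
Variables (R : realType) (I : finType) (r : I -> R).
Implicit Types S A : {set I}.

Lemma prod_add_sets (J : finType) (F H : J -> R) :
  \prod_j (F j + H j) = \sum_(T : {set J}) \prod_j (if j \in T then F j else H j).
Proof.
transitivity (\prod_j \sum_(b : bool) (if b then F j else H j)).
  by apply: eq_bigr => j _; rewrite big_bool.
rewrite bigA_distr_bigA (reindex (fun T : {set J} => [ffun j => j \in T])) /=.
  by apply: eq_bigr => T _; apply: eq_bigr => j _; rewrite ffunE.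
apply: onW_bij; exists (fun f : {ffun J -> bool} => [set j | f j]%SET) => [T|f].
  by apply/setP => j; rewrite inE ffunE.
by apply/ffunP => j; rewrite ffunE inE.
Qed.

Definition product_law S : R := \prod_i (if i \in S then r i else 1 - r i).

(** Requiring i to belong to S kills the factor 1 - r i in the expansion of a
    product of sums r i + (1 - r i). *)
Lemma sum_superset A :
  \sum_(S : {set I}) product_law S * (A \subset S)%:R = \prod_(i in A) r i.
Proof.
transitivity (\sum_(S : {set I}) \prod_i (if i \in S then r i else if i \in A then 0 else 1 - r i)).
  apply: eq_bigr => S _; have [AS|] := boolP (A \subset S).
    rewrite mulr1; apply: eq_bigr => i _; case: ifP => // iS.
    by case: ifP => // /(fintype.subsetP AS); rewrite iS.
  case/fintype.subsetPn => i iA /negPf iS; rewrite mulr0.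
  by rewrite (bigD1 i) //= iS iA mul0r.
rewrite -prod_add_sets [RHS]big_mkcond /=; apply: eq_bigr => i _.
by case: ifP => _; rewrite ?addr0 // addrC subrK.
Qed.

Lemma sum_product_law : \sum_(S : {set I}) product_law S = 1.
Proof.
have := sum_superset finset.set0; rewrite big_set0 => <-.
by apply: eq_bigr => S _; rewrite finset.sub0set mulr1.
Qed.

Section Patterns.
Variables (J : finType) (U : {set J}) (F : J -> {set I}).
Hypothesis disjF : {in U &, forall i j, i != j -> [disjoint F i & F j]%B}.

(** The patterns F j, j in U, all of whose coordinates are in the random set.  A
    singleton pattern is an edge; a pair of edges that share an end is a common
    neighbour of their other ends. *)
Definition present S : {set J} := [set j in U | F j \subset S]%SET.

Definition mean_present : R := \sum_(j in U) \prod_(i in F j) r i.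

(** Disjoint patterns are present independently.  Instead of factorizing the
    law, c ^+ #|present S| is expanded as the product of the factors
    1 + (c - 1) * (F j \subset S), so that only the probability that a union of
    patterns is contained in the random set is needed. *)
Lemma generating_function (c : R) :
  \sum_(S : {set I}) product_law S * c ^+ #|present S| =
  \prod_(j in U) (1 + (c - 1) * \prod_(i in F j) r i).
Proof.
have expand (x : J -> R) : \prod_(j in U) (1 + x j) =
    \sum_(T : {set J} | T \subset U) \prod_(j in T) x j.
  rewrite big_mkcond /= (eq_bigr (fun j => (if j \in U then x j else 0) + 1)); last first.
    by move=> j _; case: ifP; rewrite ?add0r // addrC.
  rewrite prod_add_sets [RHS]big_mkcond /=; apply: eq_bigr => T _.
  rewrite -big_mkcond /=; case: ifP => [/fintype.subsetP TU|/negbT/fintype.subsetPn[j jT /negPf jU]].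
    by apply: eq_bigr => j /TU ->.
  by rewrite (bigD1 j) //= jU mul0r.
transitivity (\sum_(S : {set I}) product_law S *
    \sum_(T : {set J} | T \subset U) \prod_(j in T) ((c - 1) * (F j \subset S)%:R)).
  apply: eq_bigr => S _; congr (_ * _); rewrite -expand -prodr_const.
  rewrite big_mkcond [RHS]big_mkcond /=; apply: eq_bigr => j _; rewrite inE.
  by case: (j \in U) => //=; case: (F j \subset S); rewrite ?mulr1 ?mulr0 ?addr0 // addrC subrK.
rewrite expand; under eq_bigr do rewrite mulr_sumr.
rewrite exchange_big /=; apply: eq_bigr => T /fintype.subsetP TU.
have cover S : \prod_(j in T) (F j \subset S)%:R = (\bigcup_(j in T) F j \subset S)%SET%:R :> R.
  have [/finset.bigcupsP sub|] := boolP (\bigcup_(j in T) F j \subset S)%SET.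
    by rewrite big1 // => j /sub ->.
  apply: contraNeq => nz; apply/finset.bigcupsP => j jT.
  by move: nz; rewrite (bigD1 j) //=; case: (F j \subset S); rewrite // mul0r eqxx.
under eq_bigr do rewrite big_split /= cover mulrCA.
rewrite -mulr_sumr sum_superset big_split /=; congr (_ * _).
pose F' j := if j \in T then F j else finset.set0.
have -> : (\bigcup_(j in T) F j)%SET = (\bigcup_j F' j)%SET by rewrite big_mkcond.
rewrite partition_disjoint_bigcup => [|i j ij]; last first.
  rewrite /F'; case: ifP => iT; case: ifP => jT; rewrite -setI_eq0 ?finset.set0I ?finset.setI0 //.
  by rewrite setI_eq0; apply: disjF; rewrite ?TU.
rewrite [RHS]big_mkcond /=; apply: eq_bigr => j _; rewrite /F'; case: ifP => // _.
by rewrite big1 // => i; rewrite inE.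
Qed.

Hypothesis r01 : forall i, 0 <= r i <= 1.

Lemma product_law_ge0 S : 0 <= product_law S.
Proof.
apply: prodr_ge0 => i _; have /andP[r0 r1] := r01 i.
by case: ifP; rewrite ?subr_ge0.
Qed.

(** From exp (- x) >= 1 - x: exp x is at most 1 / (1 - x), and
    1 / (1 - x) = 1 + x + x ^+ 2 / (1 - x). *)
Lemma expR_le_quadratic (x : R) : x <= 2^-1 -> expR x <= 1 + x + 2 * x ^+ 2.
Proof.
move=> x2; have := expR_ge1Dx (- x); rewrite expRN => ex.
have x1 : 0 < 1 - x by lra.
have : expR x <= (1 - x)^-1.
  by rewrite -[expR x]invrK lef_pV2 // posrE invr_gt0 expR_gt0.
move=> /le_trans; apply; rewrite -div1r ler_pdivrMr //.
have -> : (1 + x + 2 * x ^+ 2) * (1 - x) = 1 + x ^+ 2 * (1 - 2 * x) by ring.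
by rewrite lerDl mulr_ge0 ?sqr_ge0 //; lra.
Qed.

Lemma mean_present_ge0 : 0 <= mean_present.
Proof.
by apply: sumr_ge0 => j _; apply: prodr_ge0 => i _; case/andP: (r01 i).
Qed.

Lemma mean_present_le : mean_present <= #|U|%:R.
Proof.
rewrite -sum1_card natr_sum; apply: ler_sum => j _.
by apply: prodr_ile1 => i _; exact: r01.
Qed.

(** By 1 + y <= exp y the generating function at exp s is at most the
    exponential of (exp s - 1) times the mean, and exp s - 1 - s <= 2 * s ^+ 2
    also for negative s. *)
Lemma exp_moment_le (s : R) : s <= 2^-1 ->
  \sum_(S : {set I}) product_law S * expR (s * (#|present S|%:R - mean_present))
    <= expR (2 * s ^+ 2 * #|U|%:R).
Proof.
move=> s_le.
under eq_bigr => S _ do rewrite mulrBr expRD expRM_natr mulrA.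
rewrite -mulr_suml generating_function.
apply: (@le_trans _ _ (expR ((expR s - 1) * mean_present) * expR (- (s * mean_present)))).
  rewrite ler_wpM2r ?expR_ge0 // mulr_sumr expR_sum ler_prod // => j _.
  rewrite expR_ge1Dx andbT.
  have p01 : 0 <= \prod_(i in F j) r i <= 1.
    apply/andP; split; last by apply: prodr_ile1 => i _; exact: r01.
    by apply: prodr_ge0 => i _; case/andP: (r01 i).
  have := expR_ge0 s; move: p01; set e := expR s; set t := \prod_(i in F j) r i.
  by move=> /andP[t0 t1] e0; nra.
rewrite -expRD ler_expR.
have -> : (expR s - 1) * mean_present + - (s * mean_present) =
    (expR s - 1 - s) * mean_present by ring.
have es : expR s - 1 - s <= 2 * s ^+ 2 by have := expR_le_quadratic s_le; lra.
apply: (@le_trans _ _ (2 * s ^+ 2 * mean_present)).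
  by rewrite ler_wpM2r // mean_present_ge0.
by rewrite ler_wpM2l ?mean_present_le // mulr_ge0 ?sqr_ge0.
Qed.

(** The Chernoff bound for both tails. *)
Lemma concentration (s t : R) : 0 <= s <= 2^-1 ->
  \sum_(S | t <= `|#|present S|%:R - mean_present|) product_law S
    <= 2 * expR (2 * s ^+ 2 * #|U|%:R - s * t).
Proof.
move=> /andP[s0 s1].
have up := exp_moment_le s1.
have down : \sum_(S : {set I}) product_law S * expR (- s * (#|present S|%:R - mean_present))
    <= expR (2 * s ^+ 2 * #|U|%:R).
  by rewrite -(sqrrN s); apply: exp_moment_le; lra.
rewrite mulr2n mulrDl !mul1r expRD.
apply: (@le_trans _ _ (\sum_S (product_law S * expR (s * (#|present S|%:R - mean_present))
   + product_law S * expR (- s * (#|present S|%:R - mean_present))) * expR (- (s * t)))).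
  rewrite big_mkcond /=; apply: ler_sum => S _; rewrite -mulrDr -mulrA.
  have P0 := product_law_ge0 S; set X := _ - mean_present.
  case: ifP => [tX|_]; last by rewrite !mulr_ge0 ?addr_ge0 ?expR_ge0.
  rewrite ler_peMr // mulrDl -!expRD.
  have e0 := expR_ge0; have e1 : 1 = expR 0 :> R by rewrite expR0.
  have [X0|X0] := leP 0 X.
    rewrite -[leLHS]addr0 lerD // e1 ler_expR subr_ge0 ler_wpM2l //.
    by move: tX; rewrite ger0_norm.
  rewrite -[leLHS]add0r lerD // e1 ler_expR mulNr -mulrN -mulrBr mulr_ge0 //.
  by move: tX; rewrite ltr0_norm // subr_ge0.
rewrite -mulr_suml -mulrDl ler_wpM2r ?expR_ge0 // big_split; exact: lerD.
Qed.

End Patterns.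
End ProductLaw.

(** * Typical graphs have high probability *)

Section SBM.
Variables (R : realType) (n : nat) (p q : R).
Local Notation V := (sbm_vertex n).

Definition pair_rate (e : {set V}) : R :=
  if #|e| == 2%N then edge_prob p q e else 0.

Lemma sbm_lawE (G : sgraph V) : sbm_law p q G = product_law pair_rate (edges G).
Proof.
rewrite /sbm_law /product_law big_mkcond /=; apply: eq_bigr => e _.
rewrite /pair_rate; case: ifP => // e2; case: ifP; rewrite ?subr0 //.
by move=> /card_edge; move: e2 => /eqP.
Qed.

(** A set of vertex sets that is not a graph has a member without two elements,
    whose rate is 0; so the product law charges graphs only. *)
Lemma sum_sbm_law (Q : pred {set {set V}}) :
  \sum_(G : sgraph V | Q (edges G)) sbm_law p q G =
  \sum_(S | Q S) product_law pair_rate S.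
Proof.
pose simple (S : {set {set V}}) := [forall e in S, #|e| == 2%N].
rewrite [RHS](bigID simple) /= [X in _ + X]big1 ?addr0; last first.
  move=> S /andP[_ /forallPn[e]]; rewrite negb_imply => /andP[eS /negPf e2].
  by rewrite /product_law (bigD1 e) //= eS /pair_rate e2 mul0r.
rewrite (reindex_omap (val : sgraph V -> _) insub) /=; last first.
  by move=> S /andP[_ simpleS]; rewrite insubT.
apply: eq_big => [G|G _]; last exact: sbm_lawE.
by rewrite valK eqxx /simple (valP G) !andbT.
Qed.

Hypotheses (hp : 0 < p < 1) (hq : 0 < q < 1).

Lemma edge_prob01 (e : {set V}) : 0 <= edge_prob p q e <= 1.
Proof.
by move: hp hq => /andP[/ltW ? /ltW ?] /andP[/ltW ? /ltW ?]; rewrite /edge_prob; case: ifP => _; apply/andP.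
Qed.

Lemma pair_rate01 e : 0 <= pair_rate e <= 1.
Proof.
by rewrite /pair_rate; case: ifP => _; rewrite ?edge_prob01 // lexx ler01.
Qed.

Lemma rate01 b : 0 <= rate p q b <= 1.
Proof.
by move: hp hq => /andP[/ltW ? /ltW ?] /andP[/ltW ? /ltW ?]; case: b; apply/andP.
Qed.

Lemma pair_rate2 w u : w != u -> pair_rate [set w; u]%SET = rate p q (w.1 == u.1).
Proof.
move=> wu; rewrite /pair_rate cards2 wu /edge_prob /rate; congr (if _ then _ else _).
apply/forall_inP/eqP => [H|wu1 x].
  have := forall_inP (H w _) u; rewrite !inE !eqxx orbT => /(_ isT isT).
  by move/eqP.
rewrite !inE => /orP[] /eqP ->; apply/forall_inP => y; rewrite !inE => /orP[] /eqP ->;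
  by rewrite /same_comm ?eqxx // ?wu1 // -?wu1.
Qed.

(** Patterns are indexed by the vertices other than w and v, but the means are
    simpler over all vertices. *)
Lemma sum_minus_two (f : V -> R) (U : {set V}) (w v : V) :
  (forall u, 0 <= f u <= 1) -> (forall u, u \notin U -> u \in [:: w; v]) ->
  `|\sum_(u in U) f u - \sum_u f u| <= 2.
Proof.
move=> f01 Uc; rewrite distrC (bigID (mem U)) /= addrC addrK.
rewrite ger0_norm; last by apply: sumr_ge0 => u _; case/andP: (f01 u).
apply: (@le_trans _ _ (\sum_(u in [set w; v]%SET) 1)).
  rewrite big_mkcond [leRHS]big_mkcond /=; apply: ler_sum => u _.
  rewrite !inE; case: ifP => [/Uc|_]; last by case: ifP.
  by rewrite !inE => ->; case/andP: (f01 u).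
by rewrite sumr_const ler_nat cards2; case: (w != v).
Qed.

Section Deviation.
Variable s : R.
Hypothesis n_gt0 : (0 < n)%N.
Hypothesis s01 : 0 <= s <= 2^-1.
Hypothesis sn : 2 <= n%:R * s.
Hypothesis s2 : n%:R * s ^+ 2 = ln n%:R.

Let nR_gt0 : 0 < n%:R :> R. Proof. by rewrite ltr0n. Qed.

(** Here s is sqrt (ln n / n) and the deviation is 8 * n * s.  One n * s >= 2
    absorbs the difference between the mean and m, and the other seven give the
    exponent 2 * s ^+ 2 * (2 * n) - s * (7 * n * s) = - 3 * ln n, small enough for a
    union bound over pairs of vertices. *)
Lemma pattern_deviation (U : {set V}) (F : V -> {set {set V}}) (m : R) :
  {in U &, forall i j, i != j -> [disjoint F i & F j]%B} ->
  `|mean_present pair_rate U F - m| <= 2 ->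
  \sum_(G : sgraph V | n%:R * (8 * s) < `|#|present U F (edges G)|%:R - m|)
    sbm_law p q G <= 2 / n%:R ^+ 3.
Proof.
move=> disjF mean_m.
rewrite (sum_sbm_law (fun S => n%:R * (8 * s) < `|#|present U F S|%:R - m|)).
have := concentration disjF pair_rate01 (7 * (n%:R * s)) s01.
set b := 2 * expR _ => tail.
apply: (@le_trans _ _ b); last first.
  rewrite /b ler_pM2l // -[n%:R in leRHS](@lnK _ n%:R) ?posrE //.
  rewrite -expRM_natl -expRN ler_expR -s2.
  have : (#|U|%:R : R) <= 2 * n%:R.
    by rewrite -natrM ler_nat -card_sbm max_card.
  move=> /(ler_wpM2l (mulr_ge0 (ler0n R 2) (sqr_ge0 s))); lra.
apply: le_trans tail.
rewrite big_mkcond [leRHS]big_mkcond /=; apply: ler_sum => S _.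
have P0 := product_law_ge0 pair_rate01 S.
case: ifP => [dev|_]; last by case: ifP.
rewrite ifT //; set X := #|_|%:R in dev *; set mu := mean_present _ _ _ in mean_m *.
have : `|X - m| <= `|X - mu| + `|mu - m|.
  by rewrite (_ : X - m = (X - mu) + (mu - m)) ?ler_normD //; ring.
by have := sn; lra.
Qed.

Lemma comm_deg_deviation (w : V) c :
  \sum_(G : sgraph V | n%:R * (8 * s) < `|(comm_deg G w c)%:R - n%:R * rate p q (w.1 == c)|)
    sbm_law p q G <= 2 / n%:R ^+ 3.
Proof.
pose U := [set u : V | (u != w) && (u.1 == c)]%SET.
pose F (u : V) := [set [set w; u]%SET]%SET.
have comm_degE (G : sgraph V) : comm_deg G w c = #|present U F (edges G)|.
  apply: eq_card => u; rewrite !inE finset.sub1set.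
  have -> : ([set w; u]%SET \in edges G) = adj G w u by [].
  case wu: (adj G w u); rewrite ?andbF // !andbT.
  by rewrite [u == w]eq_sym (adj_neq wu).
under eq_bigl do rewrite comm_degE.
apply: pattern_deviation => [i j iU jU ij|].
  rewrite -setI_eq0; apply/eqP/setP => e; rewrite !inE; apply/negP.
  case/andP => /eqP -> /eqP /setP /(_ i); rewrite !inE eqxx orbT (negPf ij) orbF.
  by move: iU; rewrite inE => /andP[/negPf ->].
have -> : mean_present pair_rate U F =
    \sum_(u in [set u : V | u != w]%SET) (u.1 == c)%:R * rate p q (w.1 == c).
  rewrite /mean_present big_mkcond [RHS]big_mkcond /=; apply: eq_bigr => u _.
  rewrite !inE /F big_set1; case: (eqVneq u w) => //= uw.
  case: eqP => [<-|_]; last by rewrite mul0r.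
  by rewrite mul1r pair_rate2 // eq_sym.
have -> : n%:R * rate p q (w.1 == c) = \sum_(u : V) (u.1 == c)%:R * rate p q (w.1 == c).
  rewrite (sum_community n (fun b => (b == c)%:R * _)).
  by case: (c); rewrite /= mul1r mul0r ?addr0 ?add0r.
apply: (sum_minus_two (w := w) (v := w)) => u.
  have /andP[r0 r1] := rate01 (w.1 == c).
  by case: (u.1 == c); rewrite ?mul1r ?mul0r ?r0 ?r1 //= lexx ler01.
by rewrite !inE negbK orbb.
Qed.

(** The patterns {wz, zv} are disjoint because every edge of the pattern of z
    contains z, and no edge of another pattern does. *)
Lemma codeg_deviation (w v : V) : w != v ->
  \sum_(G : sgraph V | n%:R * (8 * s) < `|(codeg G w v)%:R - n%:R * corate p q (same_comm w v)|)
    sbm_law p q G <= 2 / n%:R ^+ 3.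
Proof.
move=> wv.
pose U := [set z : V | (z != w) && (z != v)]%SET.
pose F (z : V) := [set [set w; z]%SET; [set z; v]%SET]%SET.
have codegE (G : sgraph V) : codeg G w v = #|present U F (edges G)|.
  apply: eq_card => z; rewrite !inE finset.subUset !finset.sub1set.
  have -> : ([set w; z]%SET \in edges G) = adj G w z by [].
  have -> : ([set z; v]%SET \in edges G) = adj G z v by [].
  case wz: (adj G w z); rewrite ?andbF //; case zv: (adj G z v); rewrite ?andbF //.
  by rewrite [z == w]eq_sym (adj_neq wz) (adj_neq zv).
under eq_bigl do rewrite codegE.
apply: pattern_deviation => [i j iU jU ij|].
  rewrite -setI_eq0; apply/eqP/setP => e; rewrite !inE; apply/negP.
  move: iU; rewrite inE => /andP[/negPf iw /negPf iv].
  case/andP => ei ej.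
  have : i \in e by case/orP: ei => /eqP ->; rewrite !inE eqxx ?orbT.
  by case/orP: ej => /eqP ->; rewrite !inE ?iw ?iv (negPf ij).
pose f (z : V) := rate p q (w.1 == z.1) * rate p q (z.1 == v.1).
have -> : mean_present pair_rate U F = \sum_(z in U) f z.
  apply: eq_bigr => z; rewrite inE => /andP[zw zv].
  have wz_zv : [set w; z]%SET != [set z; v]%SET.
    by apply/eqP => /setP /(_ w); rewrite !inE eqxx /= eq_sym (negPf zw) (negPf wv).
  by rewrite /F big_setU1 ?inE //= big_set1 !pair_rate2 // eq_sym.
have -> : n%:R * corate p q (same_comm w v) = \sum_z f z.
  rewrite (sum_community n (fun b => rate p q (w.1 == b) * rate p q (b == v.1))).
  rewrite /same_comm /rate /corate; congr (_ * _).
  by case: (w.1); case: (v.1) => /=; ring.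
apply: (sum_minus_two (w := w) (v := v)) => z.
  have /andP[r0 r1] := rate01 (w.1 == z.1); have /andP[t0 t1] := rate01 (z.1 == v.1).
  by rewrite /f mulr_ge0 //= mulr_ile1.
by rewrite !inE negb_and !negbK.
Qed.

Lemma sum_sbm_law1 : \sum_(G : sgraph V) sbm_law p q G = 1.
Proof. by rewrite (sum_sbm_law xpredT) sum_product_law. Qed.

Lemma sbm_law_ge0 (G : sgraph V) : 0 <= sbm_law p q G.
Proof. by rewrite sbm_lawE product_law_ge0 //; exact: pair_rate01. Qed.

(** A union bound over the 4 n pairs of a vertex and a community and the at most
    4 n^2 pairs of vertices. *)
Lemma sbm_prob_typical :
  1 - 16 / n%:R <= sbm_prob p q [set G : sgraph V | typical p q G (8 * s)].
Proof.
pose A := [set G : sgraph V | typical p q G (8 * s)].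
pose bad1 (x : V * bool) (G : sgraph V) :=
  n%:R * (8 * s) < `|(comm_deg G x.1 x.2)%:R - n%:R * rate p q (x.1.1 == x.2)|.
pose bad2 (x : V * V) (G : sgraph V) := n%:R * (8 * s) <
  `|(codeg G x.1 x.2)%:R - n%:R * corate p q (same_comm x.1 x.2)|.
have atypical G : G \notin A -> (exists x, bad1 x G) \/ exists x, (x.1 != x.2) && bad2 x G.
  move=> GA; apply: contrapT => /not_orP[/forallNP no1 /forallNP no2].
  move/negP: GA; apply; apply/mem_set; split=> [w c|w u wu].
    by rewrite leNgt; apply/negP => b; apply: (no1 (w, c)).
  by rewrite leNgt; apply/negP => b; apply: (no2 (w, u)); rewrite wu.
rewrite lerBlDl -lerBlDr -[X in X - _]sum_sbm_law1 /sbm_prob -/A.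
rewrite [X in X - _](bigID (mem A)) /= [leLHS]addrC addKr.
apply: (@le_trans _ _ (\sum_G ((\sum_(x | bad1 x G) sbm_law p q G) +
   \sum_(x : V * V | (x.1 != x.2) && bad2 x G) sbm_law p q G))).
  rewrite big_mkcond /=; apply: ler_sum => G _; have G0 := sbm_law_ge0 G.
  have s0 (T : finType) (P : pred T) : 0 <= \sum_(x | P x) sbm_law p q G by exact: sumr_ge0.
  case: ifP => [/atypical[[x bx]|[x bx]]|_]; last by rewrite addr_ge0 ?s0.
    by rewrite (bigD1 x) //= -addrA lerDl addr_ge0 ?s0.
  by rewrite [X in _ + X](bigD1 x) //= addrCA lerDl addr_ge0 ?s0.
rewrite big_split /= (exchange_big_dep xpredT) //= [X in _ + X](exchange_big_dep (fun x : V * V => x.1 != x.2)) /=; last first.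
  by move=> G x _ /andP[].
apply: (@le_trans _ _ (\sum_(x : V * bool) 2 / n%:R ^+ 3 + \sum_(x : V * V) 2 / n%:R ^+ 3)).
  apply: lerD.
    by apply: ler_sum => -[w c] _; exact: comm_deg_deviation.
  rewrite big_mkcond /=; apply: ler_sum => -[w v] _ /=.
  case: ifP => wv; last by rewrite divr_ge0 // exprn_ge0.
  under eq_bigl do rewrite wv /=.
  exact: codeg_deviation.
rewrite !sumr_const !card_prod !card_bool !card_ord -!(mulr_natr (2 / _)) !natrM.
have n1 : 1 <= n%:R :> R by rewrite ler1n.
rewrite -mulrDr mulrAC ler_pdivrMr ?exprn_gt0 //.
rewrite (_ : 16 / n%:R * n%:R ^+ 3 = 16 * n%:R ^+ 2); last by field; rewrite gt_eqF.
by nra.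
Qed.

End Deviation.
End SBM.

(** * Asymptotics *)

(** From ln y <= y at y = sqrt x. *)
Lemma ln_div_le (R : realType) (x : R) : 0 < x -> ln x / x <= 2 / Num.sqrt x.
Proof.
move=> x0; have y0 : 0 < Num.sqrt x by rewrite sqrtr_gt0.
rewrite -{1 2}(sqr_sqrtr (ltW x0)); set y := Num.sqrt x in y0 *.
rewrite lnXn // ler_pdivrMr ?exprn_gt0 // mulr2n.
rewrite (_ : 2 / y * y ^+ 2 = y + y); last by field; rewrite gt_eqF.
by rewrite lerD // ltW // ln_sublinear.
Qed.

Lemma sbm_prob_mono (R : realType) (n : nat) (p q : R)
    (A B : set (sgraph (sbm_vertex n))) : 0 < p < 1 -> 0 < q < 1 -> A `<=` B ->
  sbm_prob p q A <= sbm_prob p q B.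
Proof.
move=> hp hq AB; rewrite /sbm_prob big_mkcond [leRHS]big_mkcond /=.
apply: ler_sum => G _; have G0 := sbm_law_ge0 hp hq G.
case: ifP => [/set_mem/AB/mem_set->//|_]; by case: ifP.
Qed.

Lemma sbm_prob_le1 (R : realType) (n : nat) (p q : R)
    (A : set (sgraph (sbm_vertex n))) : 0 < p < 1 -> 0 < q < 1 ->
  sbm_prob p q A <= 1.
Proof.
move=> hp hq; rewrite -(sum_sbm_law1 n p q) /sbm_prob big_mkcond /=.
apply: ler_sum => G _; case: ifP => _ //; exact: sbm_law_ge0.
Qed.

(** Since ln n / n <= 2 / sqrt n, s tends to 0, while n * s >= sqrt n tends to
    infinity; the last bound is ln n <= ln n ^+ 5, which holds once ln n >= 1. *)
Lemma log_scale_conditions (R : realType) (e0 : R) : 0 < e0 ->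
  \forall n \near \oo, let s := Num.sqrt (ln n%:R / n%:R) : R in
  [/\ (0 < n)%N, 0 <= s <= 2^-1, 2 <= n%:R * s, n%:R * s ^+ 2 = ln n%:R &
  [/\ n%:R^-1 <= 8 * s, 8 * s <= e0 & s <= Num.sqrt (ln n%:R ^+ 5 / n%:R)]].
Proof.
move=> e0_gt0; pose d : R := Order.min 2^-1 (e0 / 8).
have d0 : 0 < d by rewrite lt_min invr_gt0 divr_gt0 // ltr0n.
near=> n.
have n4 : 4 <= n%:R :> R by near: n; exact: nbhs_infty_ger.
have ne : expR 1 <= n%:R :> R by near: n; exact: nbhs_infty_ger.
have nd : (2 / d ^+ 2) ^+ 2 <= n%:R :> R by near: n; exact: nbhs_infty_ger.
have n0 : 0 < n%:R :> R by apply: lt_le_trans n4.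
have ln1 : 1 <= ln n%:R :> R.
  apply: le_trans (_ : ln (expR 1) <= _); first by rewrite expRK.
  by rewrite ler_ln ?posrE ?expR_gt0.
have ln0 : 0 <= ln n%:R :> R by exact: le_trans ln1.
have q0 : 0 <= ln n%:R / n%:R :> R by rewrite divr_ge0.
set s := Num.sqrt _.
have s0 : 0 <= s by exact: sqrtr_ge0.
have s2 : s ^+ 2 = ln n%:R / n%:R by rewrite sqr_sqrtr.
have ns2 : n%:R * s ^+ 2 = ln n%:R by rewrite s2 mulrC divfK // gt_eqF.
have sd : s <= d.
  rewrite -(ler_sqr (x := s)) ?nnegrE ?(ltW d0) // s2.
  apply: le_trans (ln_div_le n0) _.
  have r0 : 0 < Num.sqrt (n%:R : R) by rewrite sqrtr_gt0.
  rewrite ler_pdivrMr // mulrC -ler_pdivrMr ?exprn_gt0 //.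
  have c0 : 0 <= 2 / d ^+ 2 by rewrite divr_ge0 // exprn_ge0 // ltW.
  by rewrite -(ger0_norm c0) -sqrtr_sqr ler_wsqrtr.
have ns : 2 <= n%:R * s.
  rewrite -(ler_sqr (x := 2)) ?nnegrE ?mulr_ge0 //.
  rewrite (_ : (n%:R * s) ^+ 2 = n%:R * (n%:R * s ^+ 2)); last by ring.
  by rewrite ns2 (_ : 2 ^+ 2 = 4 * 1); [rewrite ler_pM | ring].
move: (sd); rewrite le_min => /andP[s_half s_e].
split; rewrite -?(ltr0n R) ?s0 ?s_half //; split.
- by rewrite -div1r ler_pdivrMr //; lra.
- lra.
apply: ler_wsqrtr; rewrite ler_wpM2r ?invr_ge0 // exprS ler_peMr //.
exact: exprn_ege1.
Unshelve. all: by end_near. Qed.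

Theorem corollary2 (R : realType) (p q : R) (hp : 0 < p < 1) (hq : 0 < q < 1) :
  exists C : R,
    (fun n : nat => sbm_prob p q
      [set G : sgraph (sbm_vertex n) | forall w v : sbm_vertex n, w != v ->
        (`| mean_hit R G w v
            - ((2 * #|edges G|)%:R / (deg G v)%:R - 1
               + 2 / (p + q) * (~~ adj G w v)%:R
               + (if same_comm w v
                  then - ((q - p) ^+ 2 / (p + q) ^+ 2)
                  else p * (q - p) ^+ 2 / (q * (p + q) ^+ 2)))%R%:E |
         <= (C * Num.sqrt (ln n%:R ^+ 5 / n%:R))%R%:E)%E ])
      @ \oo --> (1 : R).
Proof.
have [C [e0 [C0 e0_gt0 expansion]]] := typical_mean_hit hp hq.
exists (C * 8).
apply: (@squeeze_cvgr _ _ _ _ (fun n : nat => 1 - 16 / n%:R) (fun=> 1)); last 2 first.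
- rewrite -[X in _ --> X]subr0; apply: cvgB; first exact: cvg_cst.
  rewrite -[X in _ --> X](mulr0 16); apply: cvgMr.
  by rewrite -cvg_shiftS; exact: cvg_harmonic.
- exact: cvg_cst.
(* The typical graphs for eta = 8 * s satisfy the expansion. *)
near=> n; rewrite sbm_prob_le1 // andbT.
have [n0 s01 sn s2 [ns se s_le]] : let s := Num.sqrt (ln n%:R / n%:R) : R in
  [/\ (0 < n)%N, 0 <= s <= 2^-1, 2 <= n%:R * s, n%:R * s ^+ 2 = ln n%:R &
  [/\ n%:R^-1 <= 8 * s, 8 * s <= e0 & s <= Num.sqrt (ln n%:R ^+ 5 / n%:R)]].
  by near: n; exact: log_scale_conditions.
apply: (le_trans (sbm_prob_typical hp hq n0 s01 sn s2)).
apply: sbm_prob_mono => // G typG w v wv.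
apply: le_trans (expansion n G _ n0 ns se typG w v wv) _.
by rewrite lee_fin -mulrA ler_wpM2l // ler_pM2l.
Unshelve. all: by end_near. Qed.
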